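(* Let $n,r\in\mathbb{N}$ with $n,r\ge1$ and let $\vec n=(n_1,\dots,n_r)\in\mathcal S^r$ be the multi-index with $|\vec n|=n$. Let $a_i\in\mathbb{C}$, $b_i\in\mathbb{R}$ ($1\le i\le r$), $c,s_0\in\mathbb{R}$ and $d_1,d_2:\{1,\dots,r\}\to\{0,1\}$ be such that $d_1(i)=1$ for all $i$ or $d_2(i)=1$ for all $i$. Suppose that $w_{2,1},\dots,w_{2,r}\in L^1_{\mathcal L,\Sigma}(\mathbb{R})$ are real-valued with, for all $j\in\{1,\dots,r\}$, $$\mathcal{L}w_{2,j}(s)=\exp\left(c\int_{s_0}^s\prod_{i=1}^r\frac{(t+a_i)^{d_1(i)}}{(t+b_i)^{d_2(i)}}dt\right)\frac{s^{j-1}}{\prod_{i=1}^j(s+b_i)^{d_2(i)}},\qquad s\in\Sigma,$$ and that $\omega_{2,n}\in L^1_{\mathcal L,\Sigma}(\mathbb{R})$ satisfies $$\mathcal{L}\omega_{2,n}(s)=\exp\left(c\int_{s_0}^s\prod_{i=1}^r\frac{(t+a_i)^{d_1(i)}}{(t+b_i)^{d_2(i)}}dt\right)\frac{1}{\prod_{i=1}^r(s+b_i)^{d_2(i)n_i}},\qquad s\in\Sigma.$$ Then $\mathrm{MOPE}[n;w_{2,1},\dots,w_{2,r}]=\mathrm{PE}_{\mathrm{ADT}}[n;\omega_{2,n}]$; that is, the multiple orthogonal polynomial ensemble $\mathrm{MOPE}[n;w_{2,1},\dots,w_{2,r}]$ is of additive derivative type with respect to $\omega_{2,n}$.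
   Context: $\Sigma\subset\mathbb{R}_{>0}$ is a non-empty open interval and $L^1_{\mathcal L,\Sigma}(\mathbb{R})=\{f:\mathbb{R}\to\mathbb{C}\mid\int_{-\infty}^\infty|f(x)e^{-sx}|dx<\infty,\ s\in\Sigma\}$; functions equal a.e. are identified. The (bilateral) Laplace transform is $\mathcal{L}f(s)=\int_{-\infty}^\infty f(x)e^{-sx}dx$. A factor with exponent $0$ is $1$. The parameters are such that the displayed integrals and quotients are well defined for $s\in\Sigma$. Step-line: $\mathcal S^r=\{\vec n\in\mathbb{Z}_{\ge0}^r\mid n_1\ge\dots\ge n_r\ge n_1-1\}$, $|\vec n|=n_1+\dots+n_r$; for each $n$ there is a unique $\vec n\in\mathcal S^r$ with $|\vec n|=n$. Polynomial ensemble: for $v_1,\dots,v_n:\mathbb{R}\to\mathbb{R}$ with $x^{k-1}v_j(x)\in L^1(\mathbb{R})$ for all $j,k\in\{1,\dots,n\}$, $\mathrm{PE}[v_1,\dots,v_n]$ is the probability density on $\mathbb{R}^n$ given by $\frac1{Z_n}\prod_{1\le j<k\le n}(x_k-x_j)\det[v_j(x_k)]_{j,k=1}^n\ge0$ with normalization constant $Z_n\in\mathbb{R}\setminus\{0\}$ (so the notation presupposes that this is a well-defined probability density; in particular $v_1,\dots,v_n$ are linearly independent). $\mathrm{PE}[v_1,\dots,v_n]=\mathrm{MOPE}[n;w_1,\dots,w_r]$ means $\mathrm{span}\{v_j\}_{j=1}^n=\mathrm{span}\{x^{k-1}w_j(x)\mid k=1,\dots,n_j,\ j=1,\dots,r\}$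 for the unique $\vec n\in\mathcal S^r$ with $|\vec n|=n$. The symbol $\mathrm{MOPE}[n;w_1,\dots,w_r]$ presupposes that the associated polynomial ensemble is well defined. Functions $v_1,\dots,v_n:\mathbb{R}\to\mathbb{R}$ are of additive derivative type w.r.t. $\omega\in C^{n-2}(\mathbb{R})$ with $\omega^{(n-2)}$ locally absolutely continuous on $\mathbb{R}$ (no regularity condition if $n=1$) if $\mathrm{span}\{v_j(x)\}_{j=1}^n=\mathrm{span}\{\omega^{(j-1)}(x)\}_{j=1}^n$ for a.e. $x\in\mathbb{R}$ (equality of spans of functions, a.e.). In that case $\mathrm{PE}[v_1,\dots,v_n]$ (when it is a polynomial ensemble) is said to be of additive derivative type and one writes $\mathrm{PE}[v_1,\dots,v_n]=\mathrm{PE}_{\mathrm{ADT}}[n;\omega]$. *)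

(* Defs.v *)
From HB Require Import structures.
From mathcomp Require Import all_boot all_order all_algebra.
From mathcomp Require Import all_classical all_reals all_analysis.
From mathcomp Require Import complex.

Set Implicit Arguments.
Unset Strict Implicit.
Unset Printing Implicit Defensive.

Import Order.TTheory GRing.Theory Num.Theory.
Import numFieldNormedType.Exports.

Local Open Scope classical_set_scope.
Local Open Scope ring_scope.
Local Open Scope complex_scope.

Section complex_integration.
Context {R : realType}.
Implicit Types (D : set R) (f : R -> R[i]).

Definition cintegrable D f : Prop :=
  [/\ measurable_fun D (fun x => complex.Re (f x)),
      measurable_fun D (fun x => complex.Im (f x)) &
      (\int[@lebesgue_measure R]_(x in D) (Normc.normc (f x))%:E < +oo)%E].

Definition cintegral D f : R[i] :=
  (\int[@lebesgue_measure R]_(x in D) complex.Re (f x)) +i*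
  (\int[@lebesgue_measure R]_(x in D) complex.Im (f x)).

Definition oriented_cintegrable (a b : R) f : Prop :=
  cintegrable `[Num.min a b, Num.max a b] f.

Definition oriented_cintegral (a b : R) f : R[i] :=
  if a <= b then cintegral `[a, b] f else - cintegral `[b, a] f.

Definition cexp (z : R[i]) : R[i] :=
  (expR (complex.Re z) * cos (complex.Im z)) +i*
  (expR (complex.Re z) * sin (complex.Im z)).

Definition laplace f (s : R) : R[i] :=
  cintegral setT (fun x => f x * (expR (- (s * x)))%:C).

Definition laplace_L1 (Sigma : set R) f : Prop :=
  forall s, Sigma s -> cintegrable setT (fun x => f x * (expR (- (s * x)))%:C).

End complex_integration.

(* The n-fold product of a sigma-finite measure mu, on n-tuples with the product
   sigma-algebra: Dirac mass for n = 0, and the image of mu \x (n-fold product)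
   under (x, t) |-> x :: t for n + 1. *)
Section tuple_measure.
Context {d} {T : measurableType d} {R : realType}.

Definition tcons n (p : T * n.-tuple T) : n.+1.-tuple T := [tuple of p.1 :: p.2].

Lemma measurable_tcons n : measurable_fun setT (@tcons n).
Proof. by apply: measurable_cons; [exact: measurable_fst|exact: measurable_snd]. Qed.

(* The instance the library declares for this fact is not found by unification. *)
Lemma product_measure_sigma_finite d' (T' : measurableType d')
    (m1 : {sigma_finite_measure set T -> \bar R})
    (m2 : {sigma_finite_measure set T' -> \bar R}) :
  sigma_finite setT (m1 \x m2)%E.
Proof.
have /sigma_finiteP[F [TF ndF Foo]] := sigma_finiteT m1.
have /sigma_finiteP[G [TG ndG Goo]] := sigma_finiteT m2.
exists (fun n => F n `*` G n).
  rewrite -setXTT TF TG predeqE => -[x y]; split.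
    move=> [/= [n _ Fnx] [k _ Gky]]; exists (maxn n k) => //; split.
    - by move: x Fnx; exact/subsetPset/ndF/leq_maxl.
    - by move: y Gky; exact/subsetPset/ndG/leq_maxr.
  by move=> [n _ []/= ? ?]; split; exists n.
move=> k; have [? ?] := Foo k; have [? ?] := Goo k.
split; first exact: measurableX.
by rewrite product_measure1E// lte_mul_pinfty// ge0_fin_numE.
Qed.

Section step.
Context (mu : {sigma_finite_measure set T -> \bar R}) (n : nat)
  (m : {sigma_finite_measure set (n.-tuple T) -> \bar R}).

Definition tuple_measure_step : set (n.+1.-tuple T) -> \bar R :=
  pushforward (mu \x m)%E (@tcons n).

Let step0 : tuple_measure_step set0 = 0%E.
Proof. by rewrite /tuple_measure_step /pushforward preimage_set0 measure0. Qed.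

Let step_ge0 A : (0 <= tuple_measure_step A)%E.
Proof. exact: (measure_ge0 (mu \x m)%E (@tcons n @^-1` A)). Qed.

Let step_sigma_additive : semi_sigma_additive tuple_measure_step.
Proof.
exact: (@measure_semi_sigma_additive _ _ _
  (measure_function_pushforward__canonical__measure_function_Measure
     (mu \x m)%E (@measurable_tcons n))).
Qed.

HB.instance Definition _ := isMeasure.Build _ _ _ tuple_measure_step
  step0 step_ge0 step_sigma_additive.

Let step_sigma_finite : sigma_finite setT tuple_measure_step.
Proof.
have [F FT Foo] := product_measure_sigma_finite mu m.
pose g (t : n.+1.-tuple T) : (T * n.-tuple T)%type := (thead t, [tuple of behead t]).
have mg : measurable_fun setT g.
  apply: (@measurable_fun_pair _ _ _ _ _ _ (fun t : n.+1.-tuple T => thead t)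
    (fun t => [tuple of behead t])); last exact: measurable_behead.
  exact: measurable_tnth.
have gK : cancel (@tcons n) g.
  by move=> [x t]; congr pair => //; exact: val_inj.
exists (fun k => g @^-1` F k).
  by rewrite -preimage_bigcup -FT preimage_setT.
move=> k; have [mF Fk] := Foo k; split.
  by rewrite -[X in measurable X]setTI; exact: mg.
rewrite /tuple_measure_step /pushforward -comp_preimage.
by rewrite (_ : g \o _ = id)//; apply/funext => p; exact: gK.
Qed.

HB.instance Definition _ :=
  Measure_isSigmaFinite.Build _ _ _ tuple_measure_step step_sigma_finite.

End step.

Fixpoint tuple_measure (mu : {sigma_finite_measure set T -> \bar R}) n :
    {sigma_finite_measure set (n.-tuple T) -> \bar R} :=
  match n with
  | 0 => \d_ [tuple]
  | n'.+1 => tuple_measure_step mu (tuple_measure mu n')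
  end.

End tuple_measure.

Definition lebesgue_tuple (R : realType) n :=
  tuple_measure (@lebesgue_measure R) n.

Section polynomial_ensembles.
Context {R : realType}.
Local Notation mu := (@lebesgue_measure R).

Definition in_span (I : finType) (f : I -> R -> R) (h : R -> R) : Prop :=
  exists c : I -> R, {ae mu, forall x, h x = \sum_i c i * f i x}.

Definition same_span (I J : finType) (f : I -> R -> R) (g : J -> R -> R) : Prop :=
  forall h, in_span f h <-> in_span g h.

Definition pe_density n (v : 'I_n -> R -> R) (Z : R)
    (x : n.-tuple (measurableTypeR R)) : R :=
  Z^-1 * (\prod_(k < n) \prod_(j < n | (j < k)%N) (tnth x k - tnth x j)) *
  \det (\matrix_(j < n, k < n) v j (tnth x k)).

(* PE[v_1, ..., v_n] is well defined. *)
Definition polynomial_ensemble n (v : 'I_n -> R -> R) : Prop :=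
  (forall j k : 'I_n, mu.-integrable setT (fun x => (x ^+ k * v j x)%:E)) /\
  exists2 Z : R, Z != 0 &
    {ae lebesgue_tuple R n, forall x, 0 <= pe_density v Z x} /\
    (\int[lebesgue_tuple R n]_x (pe_density v Z x)%:E = 1)%E.

Definition step_line r (nn : r.-tuple nat) : Prop :=
  sorted geq nn /\ (head 0 nn <= (last 0 nn).+1)%N.

Definition mope_functions r (w : 'I_r -> R -> R) (nn : r.-tuple nat)
    (p : {j : 'I_r & 'I_(tnth nn j)}) : R -> R :=
  fun x => x ^+ tagged p * w (tag p) x.

(* PE[v_1, ..., v_n] = MOPE[n; w_1, ..., w_r]. *)
Definition MOPE n r (v : 'I_n -> R -> R) (w : 'I_r -> R -> R) : Prop :=
  polynomial_ensemble v /\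
  exists nn : r.-tuple nat,
    [/\ step_line nn, sumn nn = n & same_span v (@mope_functions r w nn)].

Definition continuously_differentiable (k : nat) (f : R -> R) : Prop :=
  (forall i, (i < k)%N -> forall x, derivable (derive1n i f) x 1) /\ continuous (derive1n k f).

Definition locally_absolutely_continuous (f : R -> R) : Prop :=
  forall a b : R, forall e : R, 0 < e -> exists2 d : R, 0 < d &
    forall m (x y : 'I_m -> R),
      (forall i, [/\ a <= x i, x i <= y i & y i <= b]) ->
      (forall i j, i != j -> y i <= x j \/ y j <= x i) ->
      \sum_i (y i - x i) < d ->
      \sum_i `|f (y i) - f (x i)| < e.

(* For n >= 2, omega^(n-1) is the everywhere-defined (total) derivative of the
   locally absolutely continuous omega^(n-2); it is meaningful almost everywhere,
   which is all that same_span sees. *)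
Definition additive_derivative_type n (v : 'I_n -> R -> R) (omega : R -> R) : Prop :=
  ((2 <= n)%N ->
     continuously_differentiable (n - 2) omega /\
     locally_absolutely_continuous (derive1n (n - 2) omega)) /\
  same_span v (fun j : 'I_n => derive1n j omega).

(* PE[v_1, ..., v_n] = PE_ADT[n; omega]. *)
Definition PE_ADT n (v : 'I_n -> R -> R) (omega : R -> R) : Prop :=
  polynomial_ensemble v /\ additive_derivative_type v omega.

End polynomial_ensembles.

Section laplace_exponent.
Context {R : realType}.

Definition laplace_integrand r (a : 'I_r -> R[i]) (b : 'I_r -> R)
    (d1 d2 : 'I_r -> bool) (t : R) : R[i] :=
  \prod_(i < r) ((t%:C + a i) ^+ d1 i / (t + b i)%:C ^+ d2 i).

Definition laplace_factor r (a : 'I_r -> R[i]) (b : 'I_r -> R)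
    (d1 d2 : 'I_r -> bool) (c s0 s : R) : R[i] :=
  cexp (c%:C * oriented_cintegral s0 s (laplace_integrand a b d1 d2)).

End laplace_exponent.

(* Main.v *)
Require Import Defs.
From mathcomp Require Import all_boot all_order all_algebra.
From mathcomp Require Import all_classical all_reals all_analysis.
From mathcomp Require Import measurable_realfun.
From mathcomp Require Import complex.
From mathcomp Require Import zify ring lra.

(** Let Phi be the exponential factor, g its integrand and
    Q(s) = prod_i (s + b_i)^(d2(i) n_i).  On the transform side multiplication
    by x is - d/ds, and Phi' = c g Phi, so the transform of x^k w_j is Phi times
    a rational function.  Each derivative multiplies the denominator by
    prod_i (s + b_i)^d2(i) and raises the bound on the degree of the numerator
    by r, hence the denominator of the k-th one divides
    prod_i (s + b_i)^(d2(i) (k + [i <= j])).  For k < n_j the inequalities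
    n_i >= n_j for i <= j and n_i >= n_j - 1 for all i, which characterize the
    step-line, say that this divides Q; the transform is then Phi P / Q with
    deg P < n ([real_laplace_monomial_weight_common]).

    So the Laplace transform maps the span of v, which has dimension n, into
    the n-dimensional space of the Phi P / Q with deg P < n.  It is injective
    ([real_laplace_inj_ae]), hence onto, and the span has a basis u_0, ...,
    u_(n-1) whose transforms are Phi s^j / Q ([exists_monomial_basis]).  The
    primitive from -oo divides transforms by s ([real_laplace_primitive], which
    is where s > 0 matters), so u_j is the (n-1-j)-fold primitive of u_(n-1).
    Since omega has the same transform as u_0, it is a.e. the (n-1)-fold
    primitive of an integrable function, which has the required regularity, and
    its j-th derivative is u_j a.e. ([derive1n_iter_primitive_ae]).

    Three points need an argument of their own.
    - The a_i may be complex, but the w_j are real, which forces Phi to be real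
      on Sigma; then Phi' = c Re(g) Phi there, and every polynomial above can be
      taken real ([laplace_factor_ODE]).
    - The v_i are linearly independent a.e.: a relation would make the
      determinant in the density vanish a.e., while the density has integral 1
      ([polynomial_ensemble_independent]).
    - Injectivity of the bilateral transform is proved without complex analysis.
      If the transform of f vanishes on an open set, so do all moments of
      h(x) = f(x) exp(- s x).  The bounded functions by which h can be
      multiplied without spoiling this form an algebra closed under bounded
      pointwise limits.  It contains sin and cos of small frequency, by their
      power series, then the sign of sin, and then, letting the period tend to
      infinity, the sign of x - a.  So h has integral 0 on every half-line and
      vanishes a.e. by Lebesgue differentiation. *)

Set Implicit Arguments.
Unset Strict Implicit.
Unset Printing Implicit Defensive.

Import Order.TTheory GRing.Theory Num.Theory.
Import numFieldNormedType.Exports.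

Local Open Scope classical_set_scope.
Local Open Scope ring_scope.

(** * The real Laplace transform and its derivative *)
Section differentiation.
Context {R : realType}.
Local Notation mu := (@lebesgue_measure R).
Implicit Types (S : set R) (f g : R -> R).

Lemma ae_impl (P Q : R -> Prop) : (forall x, P x -> Q x) ->
  {ae mu, forall x, P x} -> {ae mu, forall x, Q x}.
Proof.
by move=> PQ; apply: filterS; first exact: (ae_filter_ringOfSetsType mu).
Qed.

Lemma ae_and (P Q : R -> Prop) : {ae mu, forall x, P x} ->
  {ae mu, forall x, Q x} -> {ae mu, forall x, P x /\ Q x}.
Proof. by move=> aeP aeQ; apply: (@filterI _ _ (ae_filter_ringOfSetsType mu)). Qed.

Lemma ae_finite (I : finType) (P : I -> R -> Prop) : (forall i, {ae mu, forall x, P i x}) ->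
  {ae mu, forall x i, P i x}.
Proof.
move=> aeP; have F := ae_filter_ringOfSetsType mu.
by have := @filter_forall _ _ P (almost_everywhere mu) F aeP; apply: filterS.
Qed.

Definition real_laplace f (s : R) : R := \int[mu]_x (f x * expR (- (s * x))).

Definition real_laplace_L1 S f : Prop :=
  forall s, S s -> mu.-integrable setT (fun x => (f x * expR (- (s * x)))%:E).

Lemma integrable_dominated f g : measurable_fun setT f ->
  (forall x, `|f x| <= g x) -> mu.-integrable setT (EFin \o g) ->
  mu.-integrable setT (EFin \o f).
Proof.
move=> mf fg ig; apply: (le_integrable _ _ _ ig) => //.
  exact/measurable_EFinP.
move=> x _ /=; rewrite lee_fin (le_trans (fg x))// ler_norm//.
Qed.

Lemma integrable_subset (A B : set R) (f : R -> \bar R) : measurable A ->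
  measurable B -> B `<=` A -> mu.-integrable A f -> mu.-integrable B f.
Proof. by exact: (@integrableS _ _ _ mu). Qed.

Lemma integrable_sumR (I : Type) (s : seq I) (F : I -> R -> R) :
  (forall i, mu.-integrable setT (EFin \o F i)) ->
  mu.-integrable setT (EFin \o (fun x => \sum_(i <- s) F i x)).
Proof.
move=> iF; have := integrable_sum measurableT s (P := predT) (fun i _ => iF i).
by apply: eq_integrable => // x _ /=; rewrite sumEFin.
Qed.

Lemma Rintegral_sum (I : Type) (s : seq I) (F : I -> R -> R) :
  (forall i, mu.-integrable setT (EFin \o F i)) ->
  \int[mu]_x (\sum_(i <- s) F i x) = \sum_(i <- s) \int[mu]_x F i x.
Proof.
move=> iF; elim: s => [|i s IH].
  by under eq_Rintegral do rewrite big_nil; rewrite Rintegral_cst// mul0r big_nil.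
under eq_Rintegral do rewrite big_cons.
by rewrite RintegralD ?big_cons ?IH//; exact: integrable_sumR.
Qed.

Lemma measurable_expRM (s : R) : measurable_fun setT (fun x : R => expR (s * x)).
Proof. by apply: measurableT_comp => //; exact: measurable_funM. Qed.

Lemma measurable_expRNM (s : R) :
  measurable_fun setT (fun x : R => expR (- (s * x))).
Proof.
by apply: measurableT_comp => //; apply: measurable_funN; exact: measurable_funM.
Qed.

Lemma real_laplace_L1_measurable S f : S !=set0 -> real_laplace_L1 S f ->
  measurable_fun setT f.
Proof.
move=> [s Ss] /(_ s Ss)/(measurable_int mu)/measurable_EFinP mf.
rewrite (_ : f = fun x => (f x * expR (- (s * x))) * expR (s * x)).
  by apply: measurable_funM => //; exact: measurable_expRM.
by apply/funext => x; rewrite -mulrA -expRD addNr expR0 mulr1.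
Qed.

Lemma normr_le_expR (e x : R) : 0 < e ->
  `|x| <= e^-1 * expR (e * `|x|).
Proof.
move=> e0; rewrite ler_pdivlMl//; apply: le_trans (expR_ge1Dx _).
by rewrite lerDr.
Qed.

Lemma expR_norm_le (e x : R) : expR (e * `|x|) <= expR (e * x) + expR (- (e * x)).
Proof.
have [x0|x0] := leP 0 x; first by rewrite ger0_norm// lerDl expR_ge0.
by rewrite ltr0_norm// mulrN lerDr expR_ge0.
Qed.

(** A single integrable function dominates x exp(- t x) for all t within e of s:
    the factor x costs one more exponential of rate e, so it suffices to move
    the abscissa by 2 e to either side. *)
Lemma expR_strip_le (s t e x : R) : 0 < e -> `|t - s| <= e ->
  `|x| * expR (- (t * x)) <=
  e^-1 * (expR (- ((s - e *+ 2) * x)) + expR (- ((s + e *+ 2) * x))).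
Proof.
move=> e0 tse.
have -> : expR (- (t * x)) = expR (- (s * x)) * expR ((s - t) * x).
  by rewrite -expRD; congr expR; ring.
have h1 : expR ((s - t) * x) <= expR (e * `|x|).
  rewrite ler_expR (le_trans (ler_norm _))// normrM distrC.
  by rewrite ler_wpM2r.
have -> : expR (- ((s - e *+ 2) * x)) = expR (- (s * x)) * expR ((e *+ 2) * x).
  by rewrite -expRD; congr expR; ring.
have -> : expR (- ((s + e *+ 2) * x)) = expR (- (s * x)) * expR (- (e *+ 2 * x)).
  by rewrite -expRD; congr expR; ring.
rewrite -mulrDr mulrCA [leRHS]mulrCA ler_pM2l ?expR_gt0//.
apply: (@le_trans _ _ (e^-1 * expR (e *+ 2 * `|x|))); last first.
  by rewrite ler_pM2l ?invr_gt0// expR_norm_le.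
have -> : expR (e *+ 2 * `|x|) = expR (e * `|x|) * expR (e * `|x|).
  by rewrite -expRD; congr expR; ring.
by rewrite mulrA ler_pM// ?expR_ge0// normr_le_expR.
Qed.

Lemma open_strip S s : open S -> S s ->
  exists2 e : R, 0 < e & forall t, `|t - s| <= e *+ 2 -> S t.
Proof.
move=> oS Ss; have /nbhs_ballP[e /= e0 eS] : nbhs s S by exact: open_nbhs_nbhs.
exists (e / 4); first by rewrite divr_gt0.
move=> t te; apply: eS; rewrite /ball/= distrC (le_lt_trans te)//.
by lra.
Qed.

Lemma real_laplace_L1_strip S f (s e : R) : (forall t, `|t - s| <= e *+ 2 -> S t) ->
  0 < e -> real_laplace_L1 S f ->
  mu.-integrable setT (EFin \o (fun x => `|f x| * (e^-1 *
    (expR (- ((s - e *+ 2) * x)) + expR (- ((s + e *+ 2) * x)))))).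
Proof.
move=> eS e0 fL.
have i1 := fL _ (eS (s - e *+ 2) _); have i2 := fL _ (eS (s + e *+ 2) _).
have e2 : 0 <= e *+ 2 by rewrite mulrn_wge0// ltW.
rewrite addrC addKr normrN ger0_norm// in i1; rewrite addrC addKr ger0_norm// in i2.
have := integrableZl measurableT e^-1 (integrableD measurableT
  (integrable_norm (i1 (lexx _))) (integrable_norm (i2 (lexx _)))).
apply: eq_integrable => // x _ /=; rewrite -EFinD -EFinM.
congr EFin; rewrite !normrM !(ger0_norm (expR_ge0 _)).
by ring.
Qed.

Lemma real_laplace_L1_mulX S f : open S -> real_laplace_L1 S f ->
  real_laplace_L1 S (fun x => x * f x).
Proof.
move=> oS fL s Ss; have [e e0 eS] := open_strip oS Ss.
have mf : measurable_fun setT f by apply: real_laplace_L1_measurable fL; exists s.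
apply: integrable_dominated (real_laplace_L1_strip eS e0 fL).
  by apply: measurable_funM; [exact: measurable_funM|exact: measurable_expRNM].
move=> x; rewrite [_ * f x]mulrC -mulrA !normrM ler_wpM2l//.
rewrite (ger0_norm (expR_ge0 _)) expR_strip_le// subrr normr0 ltW//.
Qed.

Lemma is_derive_expRNM (x t : R) :
  is_derive t 1 (fun s => expR (- (s * x))) (- (x * expR (- (t * x)))).
Proof.
have -> : (fun s => expR (- (s * x))) = expR \o ((- x) \*: id).
  by apply/funext => s /=; congr expR; rewrite /GRing.scale/=; ring.
apply: is_derive_eq; rewrite /= /GRing.scale/=.
by rewrite (_ : - x * t = - (t * x)); ring.
Qed.

Lemma is_derive_real_laplace S f s : open S -> real_laplace_L1 S f -> S s ->
  is_derive s 1 (real_laplace f) (- real_laplace (fun x => x * f x) s).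
Proof.
move=> oS fL Ss; have [e e0 eS] := open_strip oS Ss.
have mf : measurable_fun setT f by apply: real_laplace_L1_measurable fL; exists s.
pose F (t x : R) := f x * expR (- (t * x)).
have dF (t x : R) : is_derive t 1 (F^~ x) (- (x * f x * expR (- (t * x)))).
  have := is_derive_expRNM x t => ?.
  have -> : F^~ x = f x \*: (fun t => expR (- (t * x))) by apply/funext.
  by apply: is_derive_eq; rewrite /GRing.scale/=; ring.
have Is : `]s - e, s + e[%classic s by rewrite /= in_itv/= gtrBl ltrDl e0.
have Ise t : `]s - e, s + e[%classic t -> `|t - s| <= e.
  by rewrite /= in_itv/= ler_distl => /andP[/ltW-> /ltW->].
have := real_laplace_L1_strip eS e0 fL; set G := (X in EFin \o X) => iG.
have intF t : `]s - e, s + e[%classic t -> mu.-integrable setT (EFin \o F t).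
  by move=> /Ise te; apply: fL; apply: eS; rewrite (le_trans te)// mulr2n lerDl ltW.
have dF1 t x : `]s - e, s + e[%classic t -> setT x -> derivable (F^~ x) t 1.
  by move=> _ _; apply: ex_derive.
have G0 x : 0 <= G x by rewrite /G !mulr_ge0// ?invr_ge0 ?addr_ge0 ?expR_ge0// ltW.
have Gub t x : `]s - e, s + e[%classic t -> setT x -> `|partial1of2 F t x| <= G x.
  move=> /Ise te _; rewrite partial1of2E derive_val normrN /G [_ * f x]mulrC -mulrA normrM.
  by rewrite ler_wpM2l// normrM (ger0_norm (expR_ge0 _)) expR_strip_le.
apply: DeriveDef.
  exact: (derivable_under_integral measurableT Is intF dF1 G0 iG Gub).
rewrite -derive1E (differentiation_under_integral measurableT Is intF dF1 G0 iG Gub).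
rewrite -[RHS]mulN1r -RintegralZl//; last exact: real_laplace_L1_mulX Ss.
by apply: eq_Rintegral => x _; rewrite partial1of2E derive_val mulN1r.
Qed.
End differentiation.

(** * Uniqueness of the bilateral Laplace transform *)
Section laplace_uniqueness.
Context {R : realType}.
Local Notation mu := (@lebesgue_measure R).
Implicit Types (S : set R) (f g : R -> R).

Lemma dominated_Rintegral0 (F : nat -> R -> R) f g :
  (forall n, measurable_fun setT (F n)) ->
  (forall x, F n x @[n --> \oo] --> f x) ->
  mu.-integrable setT (EFin \o g) -> (forall n x, `|F n x| <= g x) ->
  (forall n, \int[mu]_x F n x = 0) -> \int[mu]_x f x = 0.
Proof.
move=> mF Ff ig Fg F0.
have Fint n : mu.-integrable setT (EFin \o F n).
  exact: (integrable_dominated (mF n) (Fg n)).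
have cvgF : (\int[mu]_x (F n x)%:E @[n --> \oo] --> \int[mu]_x (f x)%:E)%E.
  apply: (@dominated_cvg _ _ R mu setT measurableT (fun n x => (F n x)%:E)
    (EFin \o f) (EFin \o g)).
  - by move=> n; exact: (measurable_int mu (Fint n)).
  - by move=> x _; apply: cvg_EFin; first exact: nearW; exact: Ff.
  - by [].
  - by [].
  - by move=> n x _; rewrite lee_fin.
rewrite /Rintegral -(cvg_lim _ cvgF)//.
rewrite (_ : (fun n => _) = cst 0%E) ?lim_cst//.
apply/funext => n; have /fineK <- := integrable_fin_num measurableT (Fint n).
by have := F0 n; rewrite /Rintegral => ->.
Qed.

(** The cubic y (3 - y^2) / 2 fixes -1, 0 and 1, and 1 attracts all of ]0, 1]:
    at each step its distance to 1 is multiplied by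
    1 - y (1 + y) / 2 <= 1 - u / 2. *)
Lemma iter_cubic_bounds (u : R) m : 0 < u <= 1 ->
  let q := iter m (fun y : R => y * (3 - y ^+ 2) / 2) u in
  [/\ u <= q, q <= 1 & 1 - q <= (1 - u / 2) ^+ m].
Proof.
move=> /andP[u0 u1]; elim: m => [|m] /=; first by rewrite expr0; split=> //; lra.
set q := iter m _ u => -[uq q1 qm].
have q0 : 0 < q := lt_le_trans u0 uq.
split; first nra.
  have -> : q * (3 - q ^+ 2) / 2 = 1 - (1 - q) ^+ 2 * (2 + q) / 2 by field.
  by rewrite gerBl divr_ge0// mulr_ge0 ?sqr_ge0// addr_ge0// ltW.
have -> : 1 - q * (3 - q ^+ 2) / 2 = (1 - q * (1 + q) / 2) * (1 - q) by field.
rewrite exprS ler_pM//; nra.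
Qed.

(** Iterates of an odd polynomial approximate the sign on [-1, 1], boundedly;
    this turns a trigonometric function into a square wave while remaining in an
    algebra. *)
Lemma cvg_iter_cubic (u : R) : `|u| <= 1 ->
  iter m (fun y : R => y * (3 - y ^+ 2) / 2) u @[m --> \oo] --> Num.sg u.
Proof.
wlog u0 : u / 0 < u.
  move=> hw u1; have [u0|u0|<-] := ltgtP 0 u; first exact: hw.
    have := hw (- u); rewrite oppr_gt0 normrN => /(_ u0 u1) /cvgN.
    rewrite sgrN opprK; apply: cvg_trans; apply: near_eq_cvg; apply: nearW => m.
    rewrite /= ?fctE; have -> : forall k, iter k (fun y : R => y * (3 - y ^+ 2) / 2) (- u) =
        - iter k (fun y : R => y * (3 - y ^+ 2) / 2) u.
      by elim=> //= k ->; field.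
    by rewrite ?opprK.
  rewrite sgr0 (_ : (fun m => _) = cst 0); first exact: cvg_cst.
  by apply/funext; elim=> //= k ->; rewrite mul0r mul0r.
rewrite gtr0_norm// gtr0_sg// => u1.
have bnd m := @iter_cubic_bounds u m _; rewrite u0 u1 in bnd.
apply/cvgrPdist_le => eps eps0.
have /cvgrPdist_le/(_ _ eps0) : (1 - u / 2) ^+ m @[m --> \oo] --> (0 : R).
  by apply: cvg_expr; rewrite ger0_norm; lra.
apply: filterS => m; rewrite add0r normrN; apply: le_trans.
have [] := bnd isT m => _ q1 qm.
rewrite ger0_norm ?subr_ge0// (le_trans qm)// ler_norm//.
Qed.

Variables (h : R -> R) (e : R).
Hypothesis e_gt0 : 0 < e.
Hypothesis mh : measurable_fun setT h.
Hypothesis h_exp_integrable : forall k t, `|t| <= e ->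
  mu.-integrable setT (EFin \o (fun x => h x * x ^+ k * expR (t * x))).
Hypothesis h_moment : forall k, \int[mu]_x (h x * x ^+ k) = 0.

Definition bounded_measurable (phi : R -> R) :=
  measurable_fun setT phi /\ exists C, forall x, `|phi x| <= C.

Definition orthogonal_moments phi := bounded_measurable phi /\
  forall k, \int[mu]_x (h x * x ^+ k * phi x) = 0.

(** All moments of h * phi are asked to vanish, and not only its integral, so
    that the condition survives multiplication by x, hence by a power series. *)
Definition moment_multiplier psi := bounded_measurable psi /\
  forall phi, orthogonal_moments phi -> orthogonal_moments (fun x => phi x * psi x).

Let mhk k : measurable_fun setT (fun x => h x * x ^+ k).
Proof. by apply: measurable_funM => //; exact: measurable_funX. Qed.

Lemma integrable_h_moment k : mu.-integrable setT (EFin \o (fun x => h x * x ^+ k)).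
Proof.
have := h_exp_integrable k (t := 0); rewrite normr0 => /(_ (ltW e_gt0)).
by apply: eq_integrable => // x _ /=; rewrite mul0r expR0 mulr1.
Qed.

Lemma integrable_h_momentM k phi : bounded_measurable phi ->
  mu.-integrable setT (EFin \o (fun x => h x * x ^+ k * phi x)).
Proof.
move=> [mphi [C phiC]].
apply: (@integrable_dominated _ _ (fun x => C * `|h x * x ^+ k|)).
- exact: measurable_funM.
- by move=> x; rewrite normrM mulrC ler_wpM2r.
have := integrableZl measurableT C (integrable_norm (integrable_h_moment k)).
exact: eq_integrable.
Qed.

Lemma bounded_measurableM phi psi : bounded_measurable phi -> bounded_measurable psi ->
  bounded_measurable (fun x => phi x * psi x).
Proof.
move=> [mp [C pC]] [mq [D qD]]; split; first exact: measurable_funM.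
by exists (C * D) => x; rewrite normrM ler_pM.
Qed.

Lemma bounded_measurableD phi psi : bounded_measurable phi -> bounded_measurable psi ->
  bounded_measurable (fun x => phi x + psi x).
Proof.
move=> [mp [C pC]] [mq [D qD]]; split; first exact: measurable_funD.
by exists (C + D) => x; rewrite (le_trans (ler_normD _ _))// lerD.
Qed.

Lemma bounded_measurable_cst c : bounded_measurable (fun=> c).
Proof. by split; [exact: measurable_cst|exists `|c|]. Qed.

Lemma orthogonal_moments1 : orthogonal_moments (fun=> 1).
Proof.
split; first exact: bounded_measurable_cst.
by move=> k; rewrite -[RHS](h_moment k); apply: eq_Rintegral => x _; rewrite mulr1.
Qed.

Lemma moment_multiplier_cst c : moment_multiplier (fun=> c).
Proof.
split; first exact: bounded_measurable_cst.
move=> phi [bphi phi0]; split; first exact: (bounded_measurableM bphi (bounded_measurable_cst c)).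
move=> k; under eq_Rintegral do rewrite mulrA.
by rewrite RintegralZr// ?phi0 ?mul0r//; exact: integrable_h_momentM.
Qed.

Lemma moment_multiplierM p q : moment_multiplier p -> moment_multiplier q ->
  moment_multiplier (fun x => p x * q x).
Proof.
move=> [bp ompp] [bq omq]; split; first exact: bounded_measurableM.
move=> phi /ompp/omq; congr orthogonal_moments; apply/funext => x; by rewrite mulrA.
Qed.

Lemma moment_multiplierD p q : moment_multiplier p -> moment_multiplier q ->
  moment_multiplier (fun x => p x + q x).
Proof.
move=> [bp ompp] [bq omq]; split; first exact: bounded_measurableD.
move=> phi ophi; have [b1 z1] := ompp _ ophi; have [b2 z2] := omq _ ophi.
split; first by apply: bounded_measurableM; [case: ophi|exact: bounded_measurableD].
move=> k; under eq_Rintegral do rewrite mulrDr mulrDr.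
by rewrite RintegralD ?z1 ?z2 ?addr0//; exact: integrable_h_momentM.
Qed.

Lemma moment_multiplier_lim (C : R) (p : nat -> R -> R) q : (forall n, moment_multiplier (p n)) ->
  (forall n x, `|p n x| <= C) -> (forall x, p n x @[n --> \oo] --> q x) -> moment_multiplier q.
Proof.
move=> mmp pC pq.
have bq : bounded_measurable q.
  split.
    apply: (@measurable_fun_cvg _ _ R setT p q); first by move=> n; case: (mmp n) => -[].
    by move=> x _; exact: pq.
  exists C => x; rewrite -(cvg_lim _ (cvg_norm (pq x)))//.
  apply: limr_le; first by apply: is_cvg_norm; apply/cvg_ex; eexists; exact: pq.
  by apply: nearW => n; exact: pC.
split=> // phi [bphi z]; split; first exact: bounded_measurableM.
move=> k.
have [D phiD] := bphi.2.
apply: (@dominated_Rintegral0 (fun n x => h x * x ^+ k * (phi x * p n x)) _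
   (fun x => (D * C) * `|h x * x ^+ k|)).
- move=> n; apply: measurable_funM => //; apply: measurable_funM; first exact: bphi.1.
  by case: (mmp n) => -[].
- by move=> x; apply: cvgMr; apply: cvgMr; exact: pq.
- have := integrableZl measurableT (D * C) (integrable_norm (integrable_h_moment k)).
  exact: eq_integrable.
- move=> n x; rewrite normrM mulrC ler_wpM2r// normrM ler_pM//.
- by move=> n; have [_ /(_ phi)[]] := mmp n.
Qed.

Lemma exp_partial_sum_le (y : R) n :
  0 <= y -> \sum_(0 <= i < n) y ^+ i / i`!%:R <= expR y.
Proof.
move=> y0; have := @nondecreasing_cvgn_le _ (series (exp_coeff y)).
apply; last exact: is_cvg_series_exp_coeff.
by apply: nondecreasing_series => k _ _; rewrite divr_ge0 ?exprn_ge0.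
Qed.

(** Each partial sum multiplies a function orthogonal to all moments into one of
    integral 0; the bound on the coefficients makes exp(xi |x|) a majorant of
    the partial sums, which h absorbs because xi <= e. *)
Lemma moment_multiplier_power_series (c : nat -> R) (xi : R) psi : 0 <= xi <= e ->
  bounded_measurable psi ->
  (forall i, `|c i| <= xi ^+ i / i`!%:R) ->
  (forall x, \sum_(0 <= i < n) c i * x ^+ i @[n --> \oo] --> psi x) -> moment_multiplier psi.
Proof.
move=> /andP[xi0 xie] bpsi cxi cpsi; split=> // phi [bphi z].
split; first exact: bounded_measurableM.
move=> k; have [D phiD] := bphi.2.
apply: (@dominated_Rintegral0
   (fun n x => h x * x ^+ k * (phi x * \sum_(0 <= i < n) c i * x ^+ i)) _
   (fun x => D * (`|h x * x ^+ k * expR (xi * x)| + `|h x * x ^+ k * expR (- xi * x)|))).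
- move=> n; apply: measurable_funM => //; apply: measurable_funM; first exact: bphi.1.
  by apply: measurable_sum => i; apply: measurable_funM => //; exact: measurable_funX.
- by move=> x; apply: cvgMr; apply: cvgMr; exact: cpsi.
- have i1 : `|xi| <= e by rewrite ger0_norm.
  have i2 : `|- xi| <= e by rewrite normrN.
  have := integrableZl measurableT D (integrableD measurableT
    (integrable_norm (h_exp_integrable k i1)) (integrable_norm (h_exp_integrable k i2))).
  exact: eq_integrable.
- move=> n x; rewrite normrM !(normrM (h x * _)) -mulrDr mulrCA ler_wpM2l//.
  rewrite normrM ler_pM// !(ger0_norm (expR_ge0 _)) mulNr.
  apply: le_trans (expR_norm_le _ _).
  apply: le_trans (exp_partial_sum_le n _); last by rewrite mulr_ge0.
  apply: le_trans (ler_norm_sum _ _ _) _; apply: ler_sum => i _.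
  by rewrite normrM normrX exprMn mulrAC ler_wpM2r// exprn_ge0.
- move=> n.
  have ci i : mu.-integrable setT
      (EFin \o (fun x => c i * (h x * x ^+ (k + i) * phi x))).
    have := integrableZl measurableT (c i) (integrable_h_momentM (k + i) bphi).
    exact: eq_integrable.
  rewrite (_ : (fun x => _) = (fun x => \sum_(0 <= i < n) c i * (h x * x ^+ (k + i) * phi x))).
    rewrite Rintegral_sum// big1// => i _.
    by rewrite RintegralZl ?z ?mulr0//; exact: integrable_h_momentM.
  apply/funext => x; rewrite mulrA big_distrr/=; apply: eq_bigr => i _.
  by rewrite exprD; ring.
Qed.

Lemma moment_multiplier_sin xi : 0 <= xi <= e ->
  moment_multiplier (fun x => sin (xi * x)).
Proof.
move=> xie; apply: (moment_multiplier_power_series (c := sin_coeff xi) xie).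
- split; last by exists 1 => x; exact: sin_max.
  apply: measurableT_comp; last exact: measurable_funM.
  by apply: continuous_measurable_fun; exact: continuous_sin.
- move=> i; rewrite /sin_coeff /= !normrM normfV normr_nat.
  rewrite !normrX normrN normr1 expr1n mulr1 normr_nat ger0_norm; last by case/andP: xie.
  by case: (odd i); rewrite ?mul1r// !mul0r divr_ge0// exprn_ge0//; case/andP: xie.
- move=> x; have sx : series (sin_coeff (xi * x)) @ \oo --> sin (xi * x).
    by rewrite unlock; exact: is_cvg_series_sin_coeff.
  apply: cvg_trans sx; apply: near_eq_cvg; apply: nearW => n.
  by apply: eq_bigr => i _; rewrite /sin_coeff/= exprMn; ring.
Qed.

Lemma moment_multiplier_cos xi : 0 <= xi <= e ->
  moment_multiplier (fun x => cos (xi * x)).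
Proof.
move=> xie; apply: (moment_multiplier_power_series (c := cos_coeff xi) xie).
- split; last by exists 1 => x; exact: cos_max.
  apply: measurableT_comp; last exact: measurable_funM.
  by apply: continuous_measurable_fun; exact: continuous_cos.
- move=> i; rewrite /cos_coeff /= !normrM normfV normr_nat.
  rewrite !normrX normrN normr1 expr1n mulr1 normr_nat ger0_norm; last by case/andP: xie.
  by case: (odd i); rewrite ?mul1r// !mul0r divr_ge0// exprn_ge0//; case/andP: xie.
- move=> x; have sx : series (cos_coeff (xi * x)) @ \oo --> cos (xi * x).
    by rewrite unlock; exact: is_cvg_series_cos_coeff.
  apply: cvg_trans sx; apply: near_eq_cvg; apply: nearW => n.
  by apply: eq_bigr => i _; rewrite /cos_coeff/= exprMn; ring.
Qed.

Lemma moment_multiplier_sg_sin (xi a : R) : 0 <= xi <= e ->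
  moment_multiplier (fun x => Num.sg (sin (xi * (x - a)))).
Proof.
move=> xie.
pose p m x := iter m (fun y : R => y * (3 - y ^+ 2) / 2) (sin (xi * (x - a))).
have p1 m x : `|p m x| <= 1.
  rewrite /p; elim: m => [|m] /=; first exact: sin_max.
  set q := iter m _ _; rewrite !ler_norml => /andP[q0 q1].
  have h1 : 0 <= (1 - q) ^+ 2 * (2 + q) by rewrite mulr_ge0 ?sqr_ge0//; lra.
  have h2 : 0 <= (1 + q) ^+ 2 * (2 - q) by rewrite mulr_ge0 ?sqr_ge0//; lra.
  by apply/andP; split; lra.
apply: (@moment_multiplier_lim 1 p) => //; last first.
  by move=> x; apply: cvg_iter_cubic; exact: sin_max.
elim=> [|m IH].
  rewrite /p/= (_ : (fun x => _) = fun x =>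
      sin (xi * x) * cos (xi * a) + cos (xi * x) * - sin (xi * a)).
    by apply: moment_multiplierD; (apply: moment_multiplierM; last exact: moment_multiplier_cst);
      [exact: moment_multiplier_sin|exact: moment_multiplier_cos].
  by apply/funext => x; rewrite mulrBr sinB mulrN.
rewrite (_ : p m.+1 = fun x => p m x * (3 + (-1) * (p m x * p m x)) * 2^-1).
  apply: moment_multiplierM; last exact: moment_multiplier_cst.
  apply: moment_multiplierM => //; apply: moment_multiplierD; first exact: moment_multiplier_cst.
  by apply: moment_multiplierM; [exact: moment_multiplier_cst|exact: moment_multiplierM].
by apply/funext => x; rewrite /p/=; ring.
Qed.

(** For x fixed and n large, (e / n) (x - a) lies in ]-pi, pi[, where sin has the
    sign of its argument. *)
Lemma moment_multiplier_sg (a : R) : moment_multiplier (fun x => Num.sg (x - a)).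
Proof.
apply: (@moment_multiplier_lim 1 (fun n x => Num.sg (sin (e / n.+1%:R * (x - a))))).
- move=> n; apply: moment_multiplier_sg_sin; rewrite divr_ge0 ?(ltW e_gt0)//=.
  by rewrite ler_pdivrMr// ler_peMr ?(ltW e_gt0)// ler1n.
- by move=> n x; rewrite normr_sg; case: (_ != 0).
move=> x; apply: cvg_near_cst.
have [n0 _ n0P] : \forall n \near \oo, e * `|x - a| / pi < n%:R by exact: nbhs_infty_gtr.
exists n0 => // n /= n0n.
have /n0P/= : (n0 <= n.+1)%N by rewrite ltnW.
have pi0 := pi_gt0 R.
rewrite ltr_pdivrMr// => eapi.
move: eapi {n0P n0n}; wlog xa : x a / 0 < x - a => [hw eapi|eapi].
  have [xa|xa|xa] := ltgtP 0 (x - a); first exact: hw.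
    have := hw a x; rewrite distrC -opprB oppr_gt0 => /(_ xa eapi).
    by rewrite mulrN sinN !sgrN => /oppr_inj.
  by rewrite -xa mulr0 sin0.
rewrite (gtr0_sg xa) gtr0_sg// sin_gt0_pi//.
rewrite mulr_gt0// ?divr_gt0//=.
by move: eapi; rewrite gtr0_norm// mulrAC ltr_pdivrMr// [ltRHS]mulrC.
Qed.

(** The indicator function of ]-oo, a] is 1 - (sigma + sigma^2) / 2 with sigma
    the sign of x - a, including at x = a. *)
Lemma Rintegral_Nyc_eq0 a : \int[mu]_(x in `]-oo, a]) h x = 0.
Proof.
have : moment_multiplier (fun x => 1 + - 2^-1 * (Num.sg (x - a) + Num.sg (x - a) * Num.sg (x - a))).
  apply: moment_multiplierD; first exact: moment_multiplier_cst.
  apply: moment_multiplierM; first exact: moment_multiplier_cst.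
  by apply: moment_multiplierD; [exact: moment_multiplier_sg|apply: moment_multiplierM;
    exact: moment_multiplier_sg].
case=> _ /(_ _ orthogonal_moments1)[_ /(_ 0%N)].
move=> z; rewrite Rintegral_mkcond -[RHS]z; apply: eq_Rintegral => x _.
rewrite expr0 mulr1 mul1r patchE mem_setE in_itv/=.
have [xa|xa] := leP x a; last first.
  rewrite gtr0_sg ?subr_gt0//; have -> : (point : R) = 0 by [].
  by field.
have [->|xa'] := eqVneq x a; first by rewrite subrr sgr0; field.
by rewrite ltr0_sg ?subr_lt0 ?lt_neqAle ?xa'//; field.
Qed.

Lemma moments_eq0_ae : {ae mu, forall x, h x = 0}.
Proof.
have ih : mu.-integrable setT (EFin \o h).
  by have := integrable_h_moment 0; apply: eq_integrable => // x _ /=; rewrite expr0 mulr1.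
have := @FTC1Ny R h; move=> /(_ _ _).
have i1 y : mu.-integrable `]-oo, y] (EFin \o h) by apply: integrableS ih.
have i2 : locally_integrable setT h by apply: open_integrable_locally; first exact: openT.
move=> /(_ i1 i2) /=.
apply: ae_impl => x [_].
rewrite (_ : (fun x => _) = cst 0); last by apply/funext => y; exact: Rintegral_Nyc_eq0.
by rewrite derive1_cst.
Qed.
End laplace_uniqueness.

Section laplace_uniqueness_thm.
Context {R : realType}.
Local Notation mu := (@lebesgue_measure R).
Implicit Types (S : set R) (f g : R -> R).

Lemma real_laplace_L1_mulXn S f k : open S -> real_laplace_L1 S f ->
  real_laplace_L1 S (fun x => x ^+ k * f x).
Proof.
move=> oS fL; elim: k => [|k IH].
  by under eq_fun do rewrite expr0 mul1r.
by under eq_fun do rewrite exprS -mulrA; exact: real_laplace_L1_mulX.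
Qed.

Lemma real_laplace_mulXn_eq0 S f k : open S -> real_laplace_L1 S f ->
  (forall s, S s -> real_laplace f s = 0) ->
  forall s, S s -> real_laplace (fun x => x ^+ k * f x) s = 0.
Proof.
move=> oS fL f0; elim: k => [|k IH] s Ss.
  by under eq_fun do rewrite expr0 mul1r; exact: f0.
under eq_fun do rewrite exprS -mulrA.
have := is_derive_real_laplace oS (real_laplace_L1_mulXn k oS fL) Ss => d.
apply/eqP; rewrite -oppr_eq0 -(@derive_val _ _ _ _ _ _ _ d); apply/eqP.
rewrite (@near_eq_derive _ _ _ _ (cst 0)) ?derive_cst ?oner_eq0//.
by near=> t; apply: IH; near: t; exact: open_nbhs_nbhs.
Unshelve. all: by end_near. Qed.

(** For s in S, the moments of f(x) exp(- s x) are, up to sign, the successive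
    derivatives at s of the transform of f. *)
Theorem real_laplace_eq0_ae S f : open S -> S !=set0 -> real_laplace_L1 S f ->
  (forall s, S s -> real_laplace f s = 0) -> {ae mu, forall x, f x = 0}.
Proof.
move=> oS [s Ss] fL f0; have [e e0 eS] := open_strip oS Ss.
have mf : measurable_fun setT f by apply: real_laplace_L1_measurable fL; exists s.
have := @moments_eq0_ae R (fun x => f x * expR (- (s * x))) e e0.
have mh : measurable_fun setT (fun x => f x * expR (- (s * x))).
  by apply: measurable_funM => //; exact: measurable_expRNM.
move=> /(_ mh) H.
suff : {ae mu, forall x, f x * expR (- (s * x)) = 0}.
  apply: ae_impl => x /eqP; rewrite mulf_eq0 expR_eq0 orbF => /eqP.
  exact.
apply: H.
  move=> k t te; have := real_laplace_L1_mulXn k oS fL (s := s - t); have St : S (s - t).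
    by apply: eS; rewrite addrC addKr normrN (le_trans te)// mulr2n lerDl ltW.
  move=> /(_ St); apply: eq_integrable => // x _ /=; congr EFin.
  rewrite mulrBl opprB expRD; ring.
move=> k; rewrite -[RHS](real_laplace_mulXn_eq0 k oS fL f0 Ss).
by apply: eq_Rintegral => x _; ring.
Qed.

Lemma real_laplace_L1_sum S (I : Type) (r : seq I) (c : I -> R) (F : I -> R -> R) :
  (forall i, real_laplace_L1 S (F i)) -> real_laplace_L1 S (fun x => \sum_(i <- r) c i * F i x).
Proof.
move=> FL s Ss.
have cF i : mu.-integrable setT (EFin \o (fun x => c i * F i x * expR (- (s * x)))).
  have := integrableZl measurableT (c i) (FL i s Ss).
  by apply: eq_integrable => // x _ /=; rewrite -EFinM mulrA.
apply: eq_integrable (integrable_sumR r cF) => // x _ /=.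
by rewrite big_distrl.
Qed.

Lemma real_laplace_sum S (I : Type) (r : seq I) (c : I -> R) (F : I -> R -> R) s :
  (forall i, real_laplace_L1 S (F i)) -> S s ->
  real_laplace (fun x => \sum_(i <- r) c i * F i x) s = \sum_(i <- r) c i * real_laplace (F i) s.
Proof.
move=> FL Ss; rewrite /real_laplace.
under eq_Rintegral do rewrite big_distrl/=.
rewrite Rintegral_sum; last first.
  move=> i; have := integrableZl measurableT (c i) (FL i s Ss).
  by apply: eq_integrable => // x _ /=; rewrite -EFinM mulrA.
apply: eq_bigr => i _; rewrite -RintegralZl//; last exact: FL.
by apply: eq_Rintegral => x _; rewrite mulrA.
Qed.

Theorem real_laplace_inj_ae S f g : open S -> S !=set0 -> real_laplace_L1 S f ->
  real_laplace_L1 S g ->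
  (forall s, S s -> real_laplace f s = real_laplace g s) -> {ae mu, forall x, f x = g x}.
Proof.
move=> oS S0 fL gL fg.
have L b : real_laplace_L1 S (if b then f else g) by case: b.
pose c (b : bool) : R := if b then 1 else -1.
have hE : (fun x => \sum_(b <- [:: true; false]) c b * (if b then f else g) x) =
   (fun x => f x - g x).
  by apply/funext => x; rewrite !big_cons big_nil/= /c; ring.
have : {ae mu, forall x, f x - g x = 0}.
  have hL := @real_laplace_L1_sum S bool [:: true; false] c _ L.
  rewrite hE in hL.
  apply: (real_laplace_eq0_ae oS S0 hL) => s Ss.
  rewrite -hE (real_laplace_sum _ _ L Ss) !big_cons big_nil/= /c fg//; ring.
by apply: ae_impl => x /subr0_eq.
Qed.
End laplace_uniqueness_thm.

(** * Primitives from minus infinity *)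
Section primitives.
Context {R : realType}.
Local Notation mu := (@lebesgue_measure R).
Implicit Types (S : set R) (f g : R -> R).

Definition primitive f (x : R) : R := \int[mu]_(t in `]-oo, x]) f t.

Definition left_integrable f : Prop :=
  forall y : R, mu.-integrable `]-oo, y] (EFin \o f).

Lemma real_laplace_L1_left_integrable S f s : S s -> 0 < s -> real_laplace_L1 S f ->
  left_integrable f.
Proof.
move=> Ss s0 fL y.
have mf : measurable_fun setT f by apply: real_laplace_L1_measurable fL; exists s.
have := integrableZl measurableT (expR (s * y)) (fL s Ss).
move=> /(@integrableS _ _ _ mu setT `]-oo, y] _ measurableT) => /(_ _ (@subsetT _ _)) i1.
apply: le_integrable (i1 _) => //.
  by apply/measurable_EFinP; exact: measurable_funTS.
move=> t; rewrite /= in_itv/= => ty; rewrite lee_fin mulrC -mulrA -expRD normrM ler_peMr//.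
rewrite ger0_norm ?expR_ge0// -[leLHS]expR0 ler_expR.
by rewrite addrC subr_ge0 ler_wpM2l// ltW.
Qed.

Lemma primitive_itv f x y : left_integrable f -> x <= y ->
  primitive f y - primitive f x = \int[mu]_(t in `]x, y]) f t.
Proof. by move=> fI xy; apply: Rintegral_itvB. Qed.

(** Absolute continuity of the integral, applied to the union of the disjoint
    intervals; cutting f at b makes it integrable on the whole line. *)
Lemma primitive_AC f : left_integrable f -> locally_absolutely_continuous (primitive f).
Proof.
move=> fI a b e e0.
pose g := f \_ `]-oo, b].
have ig : mu.-integrable setT (EFin \o g).
  by have := fI b; rewrite integrable_mkcond//= (restrict_EFin f).
have [d [d0 dP]] := integral_normr_continuous ig e0.
exists d => // m x y xy disj sd.
pose A i := [set` `]x i, y i]].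
have mA i : measurable (A i) by exact: measurable_itv.
have tA : trivIset setT A.
  move=> i j _ _ [t []]; rewrite /A/= !in_itv/= => /andP[xit tyi] /andP[xjt tyj].
  apply/eqP; apply/negPn/negP => /disj[h|h].
    by have := lt_le_trans (lt_le_trans xjt tyi) h; rewrite ltxx.
  by have := lt_le_trans (lt_le_trans xit tyj) h; rewrite ltxx.
pose D := \big[setU/set0]_(i < m) A i.
have mD : measurable D by apply: bigsetU_measurable.
have muD : (mu D < d%:E)%E.
  rewrite /D measure_bigsetU_ord// (eq_bigr (fun i => (y i - x i)%:E)) ?sumEFin ?lte_fin//.
  move=> i _; apply: etrans (lebesgue_measure_itv `]x i, y i]) _; rewrite /= lte_fin.
  by have [_ + _] := xy i; rewrite le_eqVlt => /predU1P[->|->]; rewrite ?ltxx ?subrr.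
apply: le_lt_trans (dP D mD muD).
have mg : measurable_fun setT g by have /integrableP[/measurable_EFinP] := ig.
have igA i : mu.-integrable (A i) (EFin \o (fun t => `|g t|)).
  by apply: (@integrableS _ _ _ mu setT) => //; [exact: mA|exact: (integrable_norm ig)].
have -> : \int[mu]_(t in D) `|g t| = \sum_(i < m) \int[mu]_(t in A i) `|g t|.
  rewrite /Rintegral /D integral_bigsetU_EFin ?index_enum_uniq//.
  - rewrite (eq_bigr (fun i => (fine (\int[mu]_(t in A i) (`|g t|)%:E))%:E)) ?sumEFin//.
    by move=> i _; rewrite fineK//; apply: integrable_fin_num; [exact: mA|exact: igA].
  - exact: sub_trivIset tA.
  - by apply/measurable_EFinP; apply: measurable_funTS; exact: measurableT_comp.
apply: ler_sum => i _; have [_ xyi yib] := xy i.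
rewrite primitive_itv//.
have fg : {in A i, f =1 g}.
  move=> t; rewrite inE/A/= in_itv/= => /andP[_ ty]; rewrite /g patchE mem_set//=.
  by rewrite in_itv/= (le_trans ty).
have -> : \int[mu]_(t in `]x i, y i]) f t = \int[mu]_(t in A i) g t.
  exact: eq_Rintegral.
apply: le_normr_Rintegral; first exact: mA.
by apply: (@integrableS _ _ _ mu setT) => //; exact: mA.
Qed.

Lemma locally_absolutely_continuous_continuous (F : R -> R) :
  locally_absolutely_continuous F -> continuous F.
Proof.
move=> acF x; apply/cvgrPdist_lt => e e0.
have [d d0 dP] := acF (x - 1) (x + 1) e e0.
near=> t.
have tx1 : `|t - x| < 1 by near: t; apply: cvgr_distC_lt => //; exact: ltr01.
have txd : `|t - x| < d by near: t; apply: cvgr_distC_lt.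
have [tx|xt] := leP t x.
  have := dP 1%N (fun=> t) (fun=> x); rewrite !big_ord1; apply.
  - move=> _; split=> //; last by lra.
    by move: tx1; rewrite ltr_distl => /andP[/ltW].
  - by move=> i j; rewrite !ord1 eqxx.
  - by move: txd; rewrite ler0_norm ?subr_le0// opprB.
rewrite distrC; have := dP 1%N (fun=> x) (fun=> t); rewrite !big_ord1; apply.
- move=> _; split=> //; [by lra|exact: ltW|].
  by move: tx1; rewrite ltr_distl => /andP[_ /ltW].
- by move=> i j; rewrite !ord1 eqxx.
- by move: txd; rewrite ger0_norm// subr_ge0 ltW.
Unshelve. all: by end_near. Qed.

Lemma primitive_continuous f : left_integrable f -> continuous (primitive f).
Proof. by move=> /primitive_AC/locally_absolutely_continuous_continuous. Qed.

Lemma derivable_primitive f x : left_integrable f -> continuous f ->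
  derivable (primitive f) x 1 /\ derive1 (primitive f) x = f x.
Proof.
move=> fI cf; apply: (@continuous_FTC1 R f -oo%O x (x + 1)).
- by rewrite ltrDl.
- exact: fI.
- by rewrite ltNyr.
- exact: cf.
Qed.

(** Lebesgue differentiation; f is locally integrable because a compact set lies
    in some ]-oo, y]. *)
Lemma derive_primitive_ae f : measurable_fun setT f -> left_integrable f ->
  {ae mu, forall x, derive1 (primitive f) x = f x}.
Proof.
move=> mf fI; have := @FTC1Ny R f fI; move=> /(_ _)/=.
have lf : locally_integrable setT f.
  split=> //; first exact: openT.
  move=> K _ cK.
  have [M [_ MK]] := compact_bounded cK.
  have KM : K `<=` `]-oo, `|M| + 1].
    move=> t Kt /=; rewrite in_itv/= (le_trans (ler_norm t))// MK//.
    by rewrite (le_lt_trans (ler_norm M))// ltrDl.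
  have iK : mu.-integrable K (EFin \o f).
    by apply: integrable_subset (fI (`|M| + 1)); [|exact: compact_measurable|].
  by have /integrableP[_] := iK.
by move=> /(_ lf); apply: ae_impl => x [].
Qed.

Lemma integral_expRNM_tail (s t : R) : 0 < s ->
  (\int[mu]_(x in `[t, +oo[) (expR (- (s * x)))%:E = (expR (- (s * t)) / s)%:E)%E.
Proof.
move=> s0; pose F x := - s^-1 * expR (- (s * x)).
have dF (x : R) : is_derive x 1 F (expR (- (s * x))).
  rewrite /F; have -> : (fun x => - s^-1 * expR (- (s * x))) =
     (- s^-1) \*: (fun x => expR (- (x * s))).
    by apply/funext => y /=; rewrite /GRing.scale/= (mulrC s).
  have := is_derive_expRNM s x => ?.
  apply: is_derive_eq; rewrite /GRing.scale/= (mulrC x) mulrN mulNr opprK mulrA mulVf ?mul1r//.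
  by rewrite gt_eqF.
have cF : continuous F by move=> x; apply: differentiable_continuous; apply/derivable1_diffP.
rewrite (@ge0_continuous_FTC2y R _ F t 0).
- by rewrite add0r -EFinN /F mulNr opprK mulrC.
- by move=> x _; exact: expR_ge0.
- apply: continuous_subspaceT => x.
  have := is_derive_expRNM x s => _.
  apply: continuous_comp; last exact: continuous_expR.
  apply: cvgN; apply: cvgMr; exact: cvg_id.
- rewrite -[X in _ --> X](mulr0 (- s^-1)); apply: cvgMr.
  have h : s * x @[x --> +oo] --> +oo by apply: gt0_cvgMry => //; exact: cvg_id.
  exact: (cvg_comp _ _ h (@cvgr_expR R)).
- by move=> x _; exact: ex_derive.
- by apply: cvg_at_right_filter; exact: cF.
- by move=> x _; rewrite derive1E derive_val.
Qed.
End primitives.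

(** * Laplace transform of a primitive *)
Section laplace_primitive.
Context {R : realType}.
Local Notation mu := (@lebesgue_measure R).
Implicit Types (S : set R) (f g : R -> R).

Definition unit_step (y x : R) : R := (y <= x)%R%:R.

Lemma unit_step_ge0 y x : 0 <= unit_step y x. Proof. by []. Qed.

Lemma integral_expRNM_step (s y : R) : 0 < s ->
  (\int[mu]_x (expR (- (s * x)) * unit_step y x)%:E = (expR (- (s * y)) / s)%:E)%E.
Proof.
move=> s0; rewrite -integral_expRNM_tail// [RHS]integral_mkcond.
apply: eq_integral => x _; rewrite patchE mem_setE in_itv/= andbT.
by rewrite /unit_step; case: (y <= x); rewrite ?mulr1 ?mulr0.
Qed.

Let measurable_expRNM_step (c : R) (y : R) :
  measurable_fun setT (fun x : R => expR (- (c * x)) * unit_step y x).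
Proof.
apply: measurable_funM; first exact: measurable_expRNM.
have -> : unit_step y = \1_`[y, +oo[.
  by apply/funext => x; rewrite /unit_step indicE mem_setE in_itv/= andbT.
exact: measurable_indic.
Qed.

Lemma integrable_expRNM_step (s y : R) : 0 < s ->
  mu.-integrable setT (EFin \o (fun x => expR (- (s * x)) * unit_step y x)).
Proof.
move=> s0; apply/integrableP; split.
  by apply/measurable_EFinP; exact: measurable_expRNM_step.
under eq_integral do rewrite /= ger0_norm ?mulr_ge0 ?expR_ge0 ?unit_step_ge0//.
by rewrite integral_expRNM_step// ltry.
Qed.

Variables (S : set R) (f : R -> R) (s : R).
Hypotheses (Ss : S s) (s0 : 0 < s) (fL : real_laplace_L1 S f).

(* Integrating K in its second variable gives the primitive of f times
   exp(- s x); integrating in the first gives f(y) exp(- s y) / s. *)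
Let K (p : R * R) : \bar R := (f p.2 * (expR (- (s * p.1)) * unit_step p.2 p.1))%:E.

Let mf : measurable_fun setT f.
Proof. by apply: real_laplace_L1_measurable fL; exists s. Qed.

Let mK : measurable_fun setT K.
Proof.
apply/measurable_EFinP; apply: measurable_funM.
  by apply: measurableT_comp => //; exact: measurable_snd.
apply: measurable_funM.
  by apply: (measurableT_comp (measurable_expRNM s)); exact: measurable_fst.
rewrite (_ : (fun p => _) = \1_[set p : R * R | p.2 <= p.1]).
  apply: measurable_indic; rewrite -[X in measurable X]setTI.
  by apply: measurable_fun_le.
by apply/funext => p; rewrite /unit_step indicE mem_setE.
Qed.

Let iK : (mu \x mu)%E.-integrable setT K.
Proof.
apply/integrable21ltyP => //.
rewrite (@eq_integral _ _ _ mu _ (fun y => (s^-1)%:E * `|(f y * expR (- (s * y)))%:E|)%E); last first.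
  move=> y _; rewrite /K /=.
  rewrite (@eq_integral _ _ _ mu _ (fun x => `|f y|%:E * (expR (- (s * x)) * unit_step y x)%:E)%E).
    rewrite ge0_integralZl// ?integral_expRNM_step//.
    - rewrite /= -!EFinM normrM (ger0_norm (expR_ge0 _)).
      by congr EFin; ring.
    - by apply/measurable_EFinP; exact: measurable_expRNM_step.
    - by move=> x _; rewrite lee_fin mulr_ge0 ?expR_ge0 ?unit_step_ge0.
  move=> x _; rewrite -EFinM normrM; congr (_ * _)%:E.
  by rewrite ger0_norm// mulr_ge0 ?expR_ge0 ?unit_step_ge0.
have /integrableP[mfe ife] := fL Ss.
rewrite ge0_integralZl//.
- by rewrite lte_mul_pinfty ?lee_fin ?invr_ge0 ?ltW.
- exact: measurableT_comp.
- by rewrite lee_fin invr_ge0 ltW.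
Qed.

Let innerG y : (\int[mu]_x K (x, y) = (f y * expR (- (s * y)) / s)%:E)%E.
Proof.
rewrite /K /=; under eq_integral do rewrite EFinM.
rewrite integralZl//; last exact: integrable_expRNM_step.
by rewrite integral_expRNM_step// -EFinM mulrA.
Qed.

Let innerF x : (\int[mu]_y K (x, y) = (primitive f x * expR (- (s * x)))%:E)%E.
Proof.
have lf := real_laplace_L1_left_integrable Ss s0 fL.
have ifx : (\int[mu]_(t in `]-oo, x]) (f t)%:E \is a fin_num)%E.
  by apply: integrable_fin_num (lf x).
rewrite /primitive EFinM /Rintegral fineK// -integralZr; [|exact: measurable_itv|exact: lf].
rewrite [RHS]integral_mkcond; apply: eq_integral => y _.
rewrite patchE mem_setE in_itv/= /K/=.
by rewrite /unit_step; case: (y <= x); rewrite ?mulr1 ?mulr0// EFinM.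
Qed.

Lemma real_laplace_L1_primitive :
  mu.-integrable setT (fun x => (primitive f x * expR (- (s * x)))%:E).
Proof.
have := integrable_fubini_F iK; apply: eq_integrable => // x _.
exact: innerF.
Qed.

Lemma real_laplace_primitive : real_laplace (primitive f) s = real_laplace f s / s.
Proof.
rewrite /real_laplace -RintegralZr//; last exact: fL.
rewrite /Rintegral; congr fine.
transitivity (\int[mu]_x \int[mu]_y K (x, y))%E.
  by apply: eq_integral => x _; rewrite innerF.
by rewrite (Fubini iK); apply: eq_integral => y _; exact: innerG.
Qed.
End laplace_primitive.

(** * Linear independence in a polynomial ensemble *)
Section ensemble_independence.
Context {R : realType}.
Local Notation mu := (@lebesgue_measure R).

(** The set is a product with one null factor, as soon as the recursion defining
    the product measure reaches the coordinate k. *)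
Lemma lebesgue_tuple_tnth_null n (N : set (measurableTypeR R)) (k : 'I_n) :
  measurable N -> mu N = 0%E ->
  measurable [set x : n.-tuple (measurableTypeR R) | N (tnth x k)] /\
  lebesgue_tuple R n [set x | N (tnth x k)] = 0%E.
Proof.
move=> mN N0.
have mNk m (j : 'I_m) : measurable [set x : m.-tuple (measurableTypeR R) | N (tnth x j)].
  rewrite -[X in measurable X]setTI.
  exact: (measurable_tnth j measurableT mN).
split=> //.
elim: n k => [[]//|n IH k].
rewrite /lebesgue_tuple /= /tuple_measure_step /pushforward.
case: (unliftP ord0 k) => [j ->|->].
  rewrite (_ : _ @^-1` _ = setT `*` [set x | N (tnth x j)]); last first.
    by apply/seteqP; split => -[x t] /=; rewrite tnthS//= => -[].
  rewrite product_measure1E; [|exact: measurableT|exact: mNk].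
  by rewrite [X in (_ * X)%E]IH mule0.
rewrite (_ : _ @^-1` _ = N `*` setT); last first.
  by apply/seteqP; split => -[x t] /=; rewrite tnth0//= => -[].
rewrite product_measure1E; [|exact: mN|exact: measurableT].
by rewrite [X in (X * _)%E]N0 mul0e.
Qed.

Lemma ae_lebesgue_tuple n (P : R -> Prop) : {ae mu, forall x, P x} ->
  {ae lebesgue_tuple R n, forall x, forall k, P (tnth x k)}.
Proof.
move=> [N [mN N0 NP]].
have Fk (k : 'I_n) : {ae lebesgue_tuple R n, forall x, P (tnth x k)}.
  have [mk k0] := lebesgue_tuple_tnth_null k mN N0.
  by exists [set x | N (tnth x k)]; split=> // x /= nP; exact: NP.
have F := ae_filter_ringOfSetsType (lebesgue_tuple R n).
by have := @filter_forall _ _ _ (almost_everywhere (lebesgue_tuple R n)) F Fk; apply: filterS.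
Qed.

Lemma measurable_pe_density n (v : 'I_n -> R -> R) (Z : R) :
  (forall i, measurable_fun setT (v i)) -> measurable_fun setT (pe_density v Z).
Proof.
move=> mv; rewrite /pe_density.
have mt (k : 'I_n) : measurable_fun setT (fun x : n.-tuple (measurableTypeR R) => (tnth x k : R)).
  exact: measurable_tnth.
apply: measurable_funM.
  apply: measurable_funM => //; apply: measurable_prod => k _.
  under eq_fun do rewrite big_mkcond/=.
  apply: measurable_prod => j _; case: (j < k)%N => //.
  exact: measurable_funB.
rewrite /determinant; apply: measurable_sum => s.
apply: measurable_funM => //; apply: measurable_prod => i _.
under eq_fun do rewrite mxE.
by apply: (measurableT_comp (mv i)); exact: mt.
Qed.

(** A relation between the v_i is, at almost every x, a relation between the
    rows of the matrix in the density, whose determinant is then 0; but the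
    density has integral 1. *)
Lemma polynomial_ensemble_independent n (v : 'I_n -> R -> R) (y : 'I_n -> R) :
  polynomial_ensemble v -> {ae mu, forall x, \sum_i y i * v i x = 0} ->
  forall i, y i = 0.
Proof.
move=> [vint [Z Z0 [_ v1]]] yv i0; apply: contrapT => /eqP yi0.
have mv i : measurable_fun setT (v i).
  have n0 : (0 < n)%N by rewrite (leq_ltn_trans (leq0n i0)).
  have /integrableP[/measurable_EFinP + _] := vint i (Ordinal n0).
  by under eq_fun do rewrite expr0 mul1r.
have d0 : {ae lebesgue_tuple R n, forall x, pe_density v Z x = 0}.
  have := ae_lebesgue_tuple n yv.
  apply: filterS; first exact: (ae_filter_ringOfSetsType (lebesgue_tuple R n)).
  move=> x xv; rewrite /pe_density.
  suff /det0P/eqP-> : exists2 u : 'rV[R]_n, u != 0 &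
      u *m \matrix_(j < n, k < n) v j (tnth x k) = 0 by rewrite mulr0.
  exists (\row_i y i).
    by apply/eqP => /rowP/(_ i0); rewrite !mxE; apply/eqP.
  apply/rowP => k; rewrite !mxE -[RHS](xv k).
  by apply: eq_bigr => i _; rewrite !mxE.
move: v1; rewrite (ae_eq_integral (cst 0%E)) ?integral0//.
- by move=> /eqP; rewrite eq_sym onee_eq0.
- by apply/measurable_EFinP; exact: measurable_pe_density.
- have [A [mA A0 dA]] := d0; exists A; split=> // x /= nx.
  by apply: dA => /= dx; apply: nx => _; rewrite dx.
Qed.
End ensemble_independence.

(** * Complex-valued integrands on the real axis *)
Section real_axis_complex.
Context {R : realType}.
Local Notation mu := (@lebesgue_measure R).
Local Open Scope complex_scope.
Implicit Types (S : set R).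

Lemma normr_Re_le (z : R[i]) : `|complex.Re z| <= Normc.normc z.
Proof. by case: z => x y /=; rewrite -sqrtr_sqr ler_sqrt ?lerDl ?sqr_ge0// addr_ge0 ?sqr_ge0. Qed.

Lemma normr_Im_le (z : R[i]) : `|complex.Im z| <= Normc.normc z.
Proof. by case: z => x y /=; rewrite -sqrtr_sqr ler_sqrt ?lerDr ?sqr_ge0// addr_ge0 ?sqr_ge0. Qed.

Lemma cintegrable_ReIm (D : set R) (f : R -> R[i]) : measurable D -> cintegrable D f ->
  mu.-integrable D (EFin \o (fun x => complex.Re (f x))) /\
  mu.-integrable D (EFin \o (fun x => complex.Im (f x))).
Proof.
move=> mD [mRe mIm foo].
have mn : measurable_fun D (fun x => Normc.normc (f x)).
  rewrite (_ : (fun x => _) =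
    (fun x => Num.sqrt (complex.Re (f x) ^+ 2 + complex.Im (f x) ^+ 2))); last first.
    by apply/funext => x; case: (f x).
  apply: measurableT_comp; first by apply: continuous_measurable_fun; exact: sqrt_continuous.
  by apply: measurable_funD; exact: measurable_funX.
have n0 x : 0 <= Normc.normc (f x) by case: (f x) => u v /=; rewrite sqrtr_ge0.
by split; apply/integrableP; split; try exact/measurable_EFinP;
  apply: le_lt_trans foo; apply: ge0_le_integral => //=;
  do ?[by move=> x _; rewrite lee_fin
      |by apply/measurable_EFinP => //; exact: measurableT_comp
      |by move=> x _; rewrite lee_fin ?normr_Re_le ?normr_Im_le].
Qed.

Lemma laplace_L1_Re S (f : R -> R[i]) : laplace_L1 S f ->
  real_laplace_L1 S (fun x => complex.Re (f x)).
Proof.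
move=> fL s Ss; have [+ _] := cintegrable_ReIm measurableT (fL s Ss).
by apply: eq_integrable => // x _ /=; case: (f x) => u v /=; congr EFin; ring.
Qed.

Lemma laplace_L1_Im S (f : R -> R[i]) : laplace_L1 S f ->
  real_laplace_L1 S (fun x => complex.Im (f x)).
Proof.
move=> fL s Ss; have [_] := cintegrable_ReIm measurableT (fL s Ss).
by apply: eq_integrable => // x _ /=; case: (f x) => u v /=; congr EFin; ring.
Qed.

Lemma laplaceE (f : R -> R[i]) s : laplace f s =
  real_laplace (fun x => complex.Re (f x)) s +i* real_laplace (fun x => complex.Im (f x)) s.
Proof.
rewrite /laplace /cintegral /real_laplace; congr (_ +i* _);
  by apply: eq_Rintegral => x _; case: (f x) => u v /=; ring.
Qed.

Lemma laplace_real (f : R -> R) s : laplace (fun x => (f x)%:C) s = (real_laplace f s)%:C.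
Proof.
rewrite laplaceE; congr (_ +i* _); rewrite /real_laplace.
by under eq_Rintegral do rewrite mul0r; rewrite Rintegral_cst// mul0r.
Qed.

Lemma prod_linear_ReIm (I : Type) (s : seq I) (a : I -> R[i]) (d : I -> bool) :
  exists P Q : {poly R}, [/\ (size P <= (size s).+1)%N, (size Q <= (size s).+1)%N &
    forall t, \prod_(i <- s) (t%:C + a i) ^+ d i = P.[t] +i* Q.[t]].
Proof.
elim: s => [|i s [P [Q [sP sQ PQ]]]].
  exists 1, 0; split=> [||t]; rewrite ?size_poly1 ?size_poly0//.
  by rewrite big_nil hornerC horner0.
case di: (d i); last first.
  exists P, Q; split=> [||t]; [exact: (leq_trans sP)|exact: (leq_trans sQ)|].
  by rewrite big_cons di expr0 mul1r.
have sM (T : {poly R}) (c : R) : (size T <= (size s).+1)%N ->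
    (size (T * ('X + c%:P))%R <= (size s).+2)%N.
  by move=> sT; rewrite (leq_trans (size_polyMleq _ _))// size_XaddC addn2.
have sC (T : {poly R}) (c : R) : (size T <= (size s).+1)%N ->
    (size (c *: T)%R <= (size s).+2)%N.
  by move=> sT; rewrite (leq_trans (size_scale_leq _ _))// ltnW.
exists (P * ('X + (complex.Re (a i))%:P) - complex.Im (a i) *: Q).
exists (Q * ('X + (complex.Re (a i))%:P) + complex.Im (a i) *: P).
split=> [||t] /=.
- by rewrite (leq_trans (size_polyD _ _))// geq_max size_polyN sM ?sC.
- by rewrite (leq_trans (size_polyD _ _))// geq_max sM ?sC.
- rewrite big_cons di PQ expr1 !hornerE; case: (a i) => x y /=.
  by simpc; congr (_ +i* _); ring.
Qed.
End real_axis_complex.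

(** * The differential equation of the exponential factor *)
Section oriented_integral.
Context {R : realType}.
Local Notation mu := (@lebesgue_measure R).
Implicit Types (S : set R) (h : R -> R).

Definition oriented_Rintegral (a b : R) h : R :=
  if a <= b then \int[mu]_(t in `[a, b]) h t else - \int[mu]_(t in `[b, a]) h t.

Lemma Rintegral_itv_split h (x y z : R) : x <= y -> y <= z ->
  mu.-integrable `[x, z] (EFin \o h) ->
  \int[mu]_(t in `[x, z]) h t = \int[mu]_(t in `[x, y]) h t + \int[mu]_(t in `[y, z]) h t.
Proof.
move=> xy yz ih; apply/eqP; rewrite addrC -subr_eq Rintegral_itvB//.
rewrite Rintegral_itv_obnd_cbnd//.
apply: integrable_subset ih => //; apply: subset_itvr.
by rewrite bnd_simp.
Qed.

Lemma oriented_Rintegral_sub h (s0 p x : R) : p <= x ->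
  mu.-integrable `[p, x] (EFin \o h) ->
  mu.-integrable `[Num.min s0 p, Num.max s0 p] (EFin \o h) ->
  mu.-integrable `[Num.min s0 x, Num.max s0 x] (EFin \o h) ->
  oriented_Rintegral s0 x h = oriented_Rintegral s0 p h + \int[mu]_(t in `[p, x]) h t.
Proof.
move=> px ipx ip ix; rewrite /oriented_Rintegral.
have [s0p|ps0] := leP s0 p.
  have s0x := le_trans s0p px; rewrite s0x.
  by apply: Rintegral_itv_split => //; move: ix; rewrite (min_idPl s0x) (max_idPr s0x).
have [s0x|xs0] := leP s0 x.
  by rewrite (@Rintegral_itv_split h p s0 x) ?addKr// ltW.
rewrite (@Rintegral_itv_split h p x s0)//; last 2 first.
  exact: ltW.
  by move: ip; rewrite (min_idPr (ltW ps0)) (max_idPl (ltW ps0)).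
by rewrite opprD addrAC addNr add0r.
Qed.

(** The base point s0 may lie outside S, where h need not be continuous; the
    integral is therefore based anew at a point p of S to the left of s. *)
Lemma is_derive_oriented_Rintegral S h (s0 s : R) : open S -> S s ->
  (forall t, S t -> {for t, continuous h}) ->
  (forall t, S t -> mu.-integrable `[Num.min s0 t, Num.max s0 t] (EFin \o h)) ->
  is_derive s 1 (fun t => oriented_Rintegral s0 t h) (h s).
Proof.
move=> oS Ss ch ih; have [e e0 eS] := open_strip oS Ss.
pose p := s - e; pose u := s + e.
have ps : p < s by rewrite /p gtrBl.
have su : s < u by rewrite /u ltrDl.
have puS t : p <= t <= u -> S t.
  move=> ptu; apply: eS; apply: (@le_trans _ _ e); last by rewrite mulr2n lerDl ltW.
  by rewrite ler_distl.
have ipx x : x <= u -> mu.-integrable `[p, x] (EFin \o h).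
  move=> xu; apply: continuous_compact_integrable; first exact: segment_compact.
  apply: continuous_in_subspaceT => t; rewrite inE/= in_itv/= => /andP[pt tx].
  by apply/ch/puS; rewrite pt (le_trans tx).
pose G x := \int[mu]_(t in `[p, x]) h t.
have [dF eF] : derivable G s 1 /\ derive1 G s = h s.
  exact: (continuous_FTC1_closed su (ipx u (lexx _)) ps (ch s Ss)).
have dG : is_derive s 1 G (h s) by rewrite derive1E in eF; exact: DeriveDef dF eF.
have := is_deriveD (is_derive_cst (oriented_Rintegral s0 p h) s 1) dG.
rewrite add0r; apply: near_eq_is_derive.
  near=> x.
  have : x \in `]p, u[ by near: x; apply: near_in_itvoo; rewrite in_itv/= ps su.
  rewrite in_itv/= => /andP[/ltW px /ltW xu].
  rewrite fctE/=; apply/esym; apply: oriented_Rintegral_sub => //; [exact: ipx|apply: ih|apply: ih];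
    apply: puS; rewrite ?lexx ?px ?xu//= ltW// (lt_trans ps).
Unshelve. all: by end_near. Qed.
End oriented_integral.

Section exponential_factor.
Context {R : realType}.
Local Notation mu := (@lebesgue_measure R).
Local Open Scope complex_scope.
Variables (Sigma : set R) (r : nat) (a : 'I_r -> R[i]) (b : 'I_r -> R)
  (d1 d2 : 'I_r -> bool) (c s0 : R).
Hypothesis Sigma_open : open Sigma.
Hypothesis quotients_defined : forall s i, Sigma s -> d2 i -> s + b i != 0.
Hypothesis integrals_defined : forall s, Sigma s ->
  oriented_cintegrable s0 s (laplace_integrand a b d1 d2).

Local Notation Phi := (laplace_factor a b d1 d2 c s0).
Hypothesis Phi_real : forall s, Sigma s -> complex.Im (Phi s) = 0.

Definition denominator : {poly R} := \prod_(i < r) ('X + (b i)%:P) ^+ d2 i.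

Lemma denominator_neq0 s : Sigma s -> denominator.[s] != 0.
Proof.
move=> Ss; rewrite /denominator horner_prod; apply/prodf_neq0 => i _.
by case di: (d2 i); rewrite ?expr0 ?expr1 !hornerE ?oner_eq0 ?quotients_defined.
Qed.

Lemma laplace_integrandE : exists P Q : {poly R}, (size P <= r.+1)%N /\
  forall t, laplace_integrand a b d1 d2 t =
    (P.[t] / denominator.[t]) +i* (Q.[t] / denominator.[t]).
Proof.
have [P [Q [sP _ PQ]]] := prod_linear_ReIm (index_enum 'I_r) a d1.
exists P, Q; split=> [|t].
  by apply: (leq_trans sP); rewrite ltnS /index_enum -enumT size_enum_ord.
rewrite /laplace_integrand.
have -> : \prod_(i < r) ((t%:C + a i) ^+ d1 i / (t + b i)%:C ^+ d2 i) =
    (P.[t] +i* Q.[t]) * (denominator.[t]^-1)%:C.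
  rewrite big_split/= PQ; congr (_ * _).
  rewrite prodfV fmorphV; congr (_^-1).
  rewrite /denominator horner_prod rmorph_prod; apply: eq_bigr => i _.
  by rewrite -rmorphXn/= horner_exp !hornerE.
by simpc.
Qed.

(** Write Phi = exp(c A) (cos(c B) + i sin(c B)).  As Phi is real, sin(c B) is 0
    on Sigma, so the term of the derivative of exp(c A) cos(c B) that contains
    B' drops out and only c A' = c Re(g) remains. *)
Lemma laplace_factor_ODE : exists2 p : {poly R}, (size p <= r.+1)%N &
  forall s, Sigma s -> is_derive s 1 (fun t => complex.Re (Phi t))
    (c * p.[s] / denominator.[s] * complex.Re (Phi s)).
Proof.
have [P [Q [sP gE]]] := laplace_integrandE.
exists P => // s Ss.
pose A t := oriented_Rintegral s0 t (fun x => complex.Re (laplace_integrand a b d1 d2 x)).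
pose B t := oriented_Rintegral s0 t (fun x => complex.Im (laplace_integrand a b d1 d2 x)).
have RePhi t : complex.Re (Phi t) = expR (c * A t) * cos (c * B t).
  rewrite /laplace_factor /oriented_cintegral /cintegral /A /B /oriented_Rintegral.
  by case: (s0 <= t); rewrite /cexp /= !mul0r subr0 addr0.
have ImPhi t : complex.Im (Phi t) = expR (c * A t) * sin (c * B t).
  rewrite /laplace_factor /oriented_cintegral /cintegral /A /B /oriented_Rintegral.
  by case: (s0 <= t); rewrite /cexp /= !mul0r subr0 addr0.
have sinB t : Sigma t -> sin (c * B t) = 0.
  by move=> /Phi_real/eqP; rewrite ImPhi mulf_eq0 expR_eq0 => /eqP.
have cR (T : {poly R}) t : Sigma t -> {for t, continuous (fun x => T.[x] / denominator.[x])}.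
  move=> St; apply: cvgM; first exact: continuous_horner.
  by apply: cvgV; [exact: denominator_neq0|exact: continuous_horner].
have mitv t : measurable (`[Num.min s0 t, Num.max s0 t] : set R) by exact: measurable_itv.
have dA : is_derive s 1 A (P.[s] / denominator.[s]).
  have -> : P.[s] / denominator.[s] = complex.Re (laplace_integrand a b d1 d2 s) by rewrite gE.
  apply: (is_derive_oriented_Rintegral Sigma_open) => // t St.
    rewrite (_ : (fun x => _) = (fun x => P.[x] / denominator.[x])); first exact: cR.
    by apply/funext => x; rewrite gE.
  by case: (cintegrable_ReIm (mitv t) (integrals_defined St)).
have dB : is_derive s 1 B (Q.[s] / denominator.[s]).
  have -> : Q.[s] / denominator.[s] = complex.Im (laplace_integrand a b d1 d2 s) by rewrite gE.
  apply: (is_derive_oriented_Rintegral Sigma_open) => // t St.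
    rewrite (_ : (fun x => _) = (fun x => Q.[x] / denominator.[x])); first exact: cR.
    by apply/funext => x; rewrite gE.
  by case: (cintegrable_ReIm (mitv t) (integrals_defined St)).
have -> : (fun t => complex.Re (Phi t)) = (expR \o (c \*: A)) * (cos \o (c \*: B)).
  by apply/funext => t; exact: RePhi.
rewrite RePhi; apply: is_derive_eq; rewrite /= /GRing.scale/= sinB//.
by rewrite oppr0; ring.
Qed.
End exponential_factor.

(** * Transforms of the functions spanning the ensemble *)
Section weighted_denominator.
Context {R : realType}.
Variables (r : nat) (b : 'I_r -> R) (d2 : 'I_r -> bool).

Definition weighted_denominator (m : 'I_r -> nat) : {poly R} :=
  \prod_(i < r) ('X + (b i)%:P) ^+ (d2 i * m i).

Local Notation D := weighted_denominator.

Lemma denominatorE : denominator b d2 = D (fun=> 1%N).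
Proof. by apply: eq_bigr => i _; rewrite muln1. Qed.

Lemma weighted_denominatorD m m' : D (fun i => m i + m' i)%N = D m * D m'.
Proof. by rewrite -big_split/=; apply: eq_bigr => i _; rewrite mulnDr exprD. Qed.

Lemma size_prod_linear (I : Type) (s : seq I) (c : I -> R) (d : I -> bool) (m : I -> nat) :
  (size (\prod_(i <- s) ('X + (c i)%:P) ^+ (d i * m i))%R <= (\sum_(i <- s) m i).+1)%N.
Proof.
elim: s => [|i s IH]; first by rewrite !big_nil size_poly1.
rewrite !big_cons (leq_trans (size_polyMleq _ _))//.
have : (size (('X + (c i)%:P) ^+ (d i * m i))%R <= (m i).+1)%N.
  rewrite (leq_trans (size_poly_exp_leq _ _))// size_XaddC mul1n.
  by case: (d i); rewrite ?mul1n ?mul0n.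
move: IH; lia.
Qed.

Lemma size_weighted_denominator m : (size (D m) <= (\sum_i m i).+1)%N.
Proof. exact: size_prod_linear. Qed.

Lemma size_denominator : (size (denominator b d2) <= r.+1)%N.
Proof.
rewrite denominatorE (leq_trans (size_weighted_denominator _))//.
by rewrite sum_nat_const card_ord muln1.
Qed.

Lemma weighted_denominator_neq0 m (s : R) :
  (forall i, d2 i -> s + b i != 0) -> (D m).[s] != 0.
Proof.
move=> sb; rewrite /D horner_prod; apply/prodf_neq0 => i _.
rewrite horner_exp !hornerE; case di: (d2 i); last by rewrite mul0n expr0 oner_eq0.
by rewrite expf_neq0// sb.
Qed.

(** The logarithmic derivative of prod_i (X + c_i)^(d_i m_i) has at most simple
    poles, at the - c_i with d_i = 1; multiplying by prod_i (X + c_i)^d_i clears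
    them. *)
Lemma prod_linear_log_deriv (I : Type) (s : seq I) (c : I -> R) (d : I -> bool) (m : I -> nat) :
  exists2 T : {poly R}, (size T <= size s)%N &
  (\prod_(i <- s) ('X + (c i)%:P) ^+ (d i * m i))^`()
    * (\prod_(i <- s) ('X + (c i)%:P) ^+ (d i * 1)) =
  \prod_(i <- s) ('X + (c i)%:P) ^+ (d i * m i) * T.
Proof.
elim: s => [|i s [T sT ET]].
  by exists 0; rewrite ?size_poly0// !big_nil derivC mul0r mulr0.
have := size_prod_linear s c d (fun=> 1%N).
rewrite !big_cons; move: ET; set A := \prod_(j <- s) _; set q := \prod_(j <- s) _.
move=> ET sq; case di: (d i); last first.
  by exists T; [exact: (leq_trans sT)|rewrite !mul0n !expr0 !mul1r].
have dL : ('X + (c i)%:P)^`() = 1 :> {poly R} by rewrite derivD derivX derivC addr0.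
exists ((m i)%:R *: q + ('X + (c i)%:P) * T).
  rewrite (leq_trans (size_polyD _ _))// geq_max; apply/andP; split.
    by rewrite (leq_trans (size_scale_leq _ _))// (leq_trans sq)// sum1_size.
  by rewrite (leq_trans (size_polyMleq _ _))// size_XaddC.
rewrite !mul1n expr1 derivM deriv_exp dL mul1r -mulr_natl scaler_nat -mulr_natl.
set L := 'X + _ in dL *.
have mL : (m i)%:R * L ^+ (m i).-1 * L = (m i)%:R * L ^+ m i :> {poly R}.
  by case: (m i) => [|k]; rewrite ?mul0r// -mulrA -exprSr.
transitivity ((m i)%:R * L ^+ (m i).-1 * L * (A * q) + L ^+ m i * L * (A^`() * q)).
  by ring.
by rewrite mL ET; ring.
Qed.

Lemma weighted_denominator_log_deriv m : exists2 T : {poly R}, (size T <= r)%N &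
  (D m)^`() * denominator b d2 = D m * T.
Proof.
have [T sT ET] := prod_linear_log_deriv (index_enum 'I_r) b d2 m.
exists T; last by rewrite denominatorE.
by apply: (leq_trans sT); rewrite /index_enum -enumT size_enum_ord.
Qed.

End weighted_denominator.

Section moment_transforms.
Context {R : realType}.
Variables (Sigma : set R) (r : nat) (b : 'I_r -> R) (d2 : 'I_r -> bool)
  (c : R) (p : {poly R}) (phi : R -> R) (w : 'I_r -> R -> R).
Hypothesis Sigma_open : open Sigma.
Hypothesis quotients_defined : forall s i, Sigma s -> d2 i -> s + b i != 0.
Hypothesis size_p : (size p <= r.+1)%N.
Hypothesis phi_ODE : forall s, Sigma s ->
  is_derive s 1 phi (c * p.[s] / (denominator b d2).[s] * phi s).
Hypothesis w_L1 : forall j, real_laplace_L1 Sigma (w j).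

Local Notation D := (weighted_denominator b d2).
Local Notation q := (denominator b d2).

(** With q the denominator of g and T the polynomial of
    [weighted_denominator_log_deriv], the new numerator is
    c p P + q P' - P T. *)
Lemma is_derive_phi_fraction (P : {poly R}) (m : 'I_r -> nat) :
  exists2 P1 : {poly R}, (size P1 <= size P + r)%N &
  forall s, Sigma s -> is_derive s 1 (fun t => phi t * (P.[t] / (D m).[t]))
    (phi s * (P1.[s] / (D (fun i => (m i).+1)).[s])).
Proof.
have [T sT DT] := weighted_denominator_log_deriv b d2 m.
exists (c *: (p * P) + q * P^`() - P * T).
  have sq := size_denominator b d2.
  have [->|P0] := eqVneq P 0.
    by rewrite derivC !(mulr0, mul0r) scaler0 addr0 subr0 size_poly0.
  have sP : (0 < size P)%N by rewrite size_poly_gt0.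
  have sP' : (size P^`() < size P)%N by exact: lt_size_deriv.
  have h1 : (size (c *: (p * P))%R <= size P + r)%N.
    rewrite (leq_trans (size_scale_leq _ _))// (leq_trans (size_polyMleq _ _))//.
    by move: size_p sP; lia.
  have h2 : (size (q * P^`())%R <= size P + r)%N.
    by rewrite (leq_trans (size_polyMleq _ _))//; move: sq sP' sP; lia.
  have h3 : (size (P * T)%R <= size P + r)%N.
    by rewrite (leq_trans (size_polyMleq _ _))//; move: sT; lia.
  by rewrite (leq_trans (size_polyD _ _))// geq_max size_polyN h3 andbT
    (leq_trans (size_polyD _ _))// geq_max h1.
move=> s Ss; have dphi := phi_ODE Ss.
have D0 : (D m).[s] != 0 by apply: weighted_denominator_neq0 => i; exact: quotients_defined.
have q0 : q.[s] != 0 := denominator_neq0 quotients_defined Ss.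
have -> : D (fun i => (m i).+1) = D m * q.
  by rewrite denominatorE -weighted_denominatorD; congr D; apply/funext => i; rewrite addn1.
have dD := is_derive_poly (D m) s.
have dV : is_derive s 1 (fun t => ((D m).[t])^-1) (- (D m).[s] ^- 2 *: (D m)^`().[s]).
  apply: DeriveDef; first by apply: derivableV => //; exact: ex_derive.
  by rewrite deriveV ?derive_val//; exact: ex_derive.
have dF := is_deriveM dphi (is_deriveM (is_derive_poly P s) dV).
have /(congr1 (fun T => T.[s])) := DT; rewrite !hornerM => eD.
have eD' : (D m)^`().[s] = (D m).[s] * T.[s] / q.[s] by rewrite -eD mulfK.
apply: is_derive_eq; rewrite eD' /GRing.scale/= !(hornerD, hornerN, hornerM, hornerZ).
have -> : (horner P * (fun t : R => (D m).[t]^-1)) s = P.[s] / (D m).[s] by [].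
by field; rewrite D0 q0.
Qed.

(** Differentiate k times; the bound k r + j on the degree of the numerator is
    the sum over i of the exponents k + [i <= j], minus one. *)
Lemma real_laplace_monomial_weight (j : 'I_r) :
  (forall s, Sigma s -> real_laplace (w j) s =
     phi s * (s ^+ j / (D (fun i => (i <= j)%N)).[s])) ->
  forall k, exists2 P : {poly R}, (size P <= k * r + j.+1)%N &
  forall s, Sigma s -> real_laplace (fun x => x ^+ k * w j x) s =
     phi s * (P.[s] / (D (fun i => k + (i <= j)%N)%N).[s]).
Proof.
move=> wj; elim=> [|k [P sP PE]].
  exists 'X^j; first by rewrite size_polyXn.
  by move=> s Ss; under eq_fun do rewrite expr0 mul1r; rewrite hornerXn wj.
have [P1 sP1 dP1] := is_derive_phi_fraction P (fun i => k + (i <= j)%N)%N.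
exists (- P1); first by rewrite size_polyN mulSn (leq_trans sP1)//; move: sP; lia.
move=> s Ss; under eq_fun do rewrite exprS -mulrA.
have d1 := is_derive_real_laplace Sigma_open (real_laplace_L1_mulXn k Sigma_open (w_L1 j)) Ss.
have d2' : is_derive s 1 (real_laplace (fun x => x ^+ k * w j x))
    (phi s * (P1.[s] / (D (fun i => (k + (i <= j)).+1)%N).[s])).
  apply: near_eq_is_derive (dP1 s Ss).
  by near=> t; apply/esym/PE; near: t; exact: open_nbhs_nbhs.
have /eqP := etrans (esym (@derive_val _ _ _ _ _ _ _ d1)) (@derive_val _ _ _ _ _ _ _ d2').
rewrite eqr_oppLR => /eqP ->.
by rewrite hornerN mulNr mulrN.
Unshelve. all: by end_near. Qed.

(** Reducing to the common denominator D nn multiplies the numerator by the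
    product of the (X + b_i)^(d2(i) (nn_i - k - [i <= j])), of degree at most
    the sum of nn minus k r + j + 1. *)
Lemma real_laplace_monomial_weight_common (j : 'I_r) (nn : 'I_r -> nat) k :
  (forall s, Sigma s -> real_laplace (w j) s =
     phi s * (s ^+ j / (D (fun i => (i <= j)%N)).[s])) ->
  (forall i : 'I_r, k + (i <= j) <= nn i)%N ->
  exists2 P : {poly R}, (size P <= \sum_i nn i)%N &
  forall s, Sigma s -> real_laplace (fun x => x ^+ k * w j x) s =
     phi s * (P.[s] / (D nn).[s]).
Proof.
move=> wj kn; have [P sP PE] := real_laplace_monomial_weight wj k.
pose m (i : 'I_r) := (k + (i <= j)%N)%N; pose e (i : 'I_r) := (nn i - m i)%N.
have nnE : nn = (fun i => m i + e i)%N by apply/funext => i; rewrite /e subnKC ?kn.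
exists (P * D e).
  have sm : (\sum_i m i = k * r + j.+1)%N.
    rewrite big_split/= sum_nat_const card_ord mulnC; congr addn.
    rewrite -(big_mkord xpredT (fun i => nat_of_bool (i <= j)%N)).
    have z : (\sum_(j.+1 <= i < r) nat_of_bool (i <= j) = 0)%N.
      by rewrite big_nat big1// => i /andP[ji _]; rewrite leqNgt ji.
    rewrite (big_cat_nat (n := j.+1))//= z addn0.
    rewrite big_nat (eq_bigr (fun=> 1%N)); last by move=> i; rewrite ltnS => /andP[_ ->].
    by rewrite -big_nat sum_nat_const_nat subn0 muln1.
  have -> : (\sum_i nn i = \sum_i m i + \sum_i e i)%N by rewrite -big_split nnE.
  rewrite sm (leq_trans (size_polyMleq _ _))//.
  by have := size_weighted_denominator b d2 e; move: sP; lia.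
have Dnn : D nn = D m * D e by rewrite nnE weighted_denominatorD.
move=> s Ss; rewrite (PE s Ss) -/m Dnn !hornerM.
have D0 k' : (D k').[s] != 0 by apply: weighted_denominator_neq0 => i; exact: quotients_defined.
by field; rewrite (D0 m) (D0 e).
Qed.
End moment_transforms.

(** * Multi-indices on the step-line *)
Section step_lines.

Lemma step_line_leq r (nn : r.-tuple nat) (i j : 'I_r) : step_line nn ->
  ((i <= j -> tnth nn j <= tnth nn i) /\ tnth nn i <= (tnth nn j).+1)%N.
Proof.
move=> [snn hl].
have gT : transitive geq by move=> y x z /= xy yz; exact: leq_trans yz xy.
have gR : reflexive geq by move=> x /=.
have nth_anti (k l : nat) : (k <= l)%N -> (l < r)%N -> (nth 0%N nn l <= nth 0%N nn k)%N.
  move=> kl lr; apply: (sorted_leq_nth gT gR 0%N snn) => //;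
    by rewrite inE size_tuple// (leq_ltn_trans kl).
rewrite !(tnth_nth 0%N); split=> [ij|]; first exact: nth_anti.
have r0 : (0 < r)%N by rewrite (leq_ltn_trans _ (ltn_ord i)).
rewrite (leq_trans (nth_anti 0%N i _ _))// nth0 (leq_trans hl)// ltnS -nth_last size_tuple.
by apply: nth_anti; rewrite ?prednK// -ltnS prednK.
Qed.

(** If m_i < m'_i for one i, then m_j <= m'_j for all j, so that the sums differ:
    m_j <= m_i <= m'_i - 1 <= m'_j for j after i, and
    m_j <= m_i + 1 <= m'_i <= m'_j for j before i. *)
Lemma step_line_uniq r (m m' : r.-tuple nat) : step_line m -> step_line m' ->
  sumn m = sumn m' -> m = m'.
Proof.
move=> sm sm'.
have sumE (t : r.-tuple nat) : sumn t = (\sum_i tnth t i)%N.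
  by rewrite sumnE big_tuple.
rewrite !sumE => e.
have key (u u' : r.-tuple nat) (i : 'I_r) : step_line u -> step_line u' ->
    (tnth u i < tnth u' i)%N -> (\sum_i tnth u i < \sum_i tnth u' i)%N.
  move=> su su' ui; rewrite (bigD1 i)//= [ltnRHS](bigD1 i)//= -addSn leq_add//.
  apply: leq_sum => j _.
  have [ij|ji] := leqP i j.
    have := (step_line_leq i j su).1 ij; have := (step_line_leq i j su').2; move: ui; lia.
  have := (step_line_leq j i su).2; have := (step_line_leq j i su').1 (ltnW ji); move: ui; lia.
apply: eq_from_tnth => i; have [h|h|//] := ltngtP (tnth m i) (tnth m' i).
  by have := key _ _ _ sm sm' h; rewrite e ltnn.
by have := key _ _ _ sm' sm h; rewrite e ltnn.
Qed.
End step_lines.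

(** * Spans and bases *)
Section spans.
Context {R : realType}.
Local Notation mu := (@lebesgue_measure R).

Lemma in_span_mul (I J : finType) (f : I -> R -> R) (g : J -> R -> R) (A : I -> J -> R) h :
  (forall i, {ae mu, forall x, f i x = \sum_j A i j * g j x}) ->
  in_span f h -> in_span g h.
Proof.
move=> /ae_finite fg [c hc]; exists (fun j => \sum_i c i * A i j).
apply: ae_impl (ae_and hc fg) => x [-> fgx].
under eq_bigr do rewrite fgx big_distrr/=.
rewrite exchange_big/=; apply: eq_bigr => j _; rewrite big_distrl/=.
by apply: eq_bigr => i _; rewrite mulrA.
Qed.

Lemma same_span_ae (I J : finType) (f : I -> R -> R) (g g' : J -> R -> R) :
  (forall j, {ae mu, forall x, g j x = g' j x}) -> same_span f g -> same_span f g'.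
Proof.
move=> /ae_finite gg' fg h; split.
  move=> /fg[c hc]; exists c; apply: ae_impl (ae_and hc gg') => x [-> e].
  by apply: eq_bigr => j _; rewrite e.
move=> [c hc]; apply/fg; exists c; apply: ae_impl (ae_and hc gg') => x [-> e].
by apply: eq_bigr => j _; rewrite e.
Qed.

Lemma in_span_mem (I : finType) (f : I -> R -> R) i : in_span f (f i).
Proof.
exists (fun j => (j == i)%:R); apply: aeW => x.
by rewrite (bigD1 i)//= eqxx mul1r big1 ?addr0// => j /negPf ->; rewrite mul0r.
Qed.
End spans.

Section polynomial_basis.
Context {R : realType}.
Local Notation mu := (@lebesgue_measure R).
Variables (Sigma : set R) (phi : R -> R) (n : nat) (I : finType) (g : I -> R -> R).
Hypotheses (Sigma_open : open Sigma) (Sigma_nonempty : Sigma !=set0).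
Hypothesis g_L1 : forall i, real_laplace_L1 Sigma (g i).
Hypothesis g_laplace : forall i, exists2 P : {poly R}, (size P <= n)%N &
  forall s, Sigma s -> real_laplace (g i) s = phi s * P.[s].
Variable v : 'I_n -> R -> R.
Hypothesis v_span : forall i, in_span g (v i).
Hypothesis v_independent : forall y : 'I_n -> R,
  {ae mu, forall x, \sum_i y i * v i x = 0} -> forall i, y i = 0.

(** The coefficients of the numerators form a square matrix M.  A row vector in
    its left kernel gives a combination of the v_i with transform 0, hence a
    trivial one; so M is invertible and its inverse gives the basis. *)
Lemma exists_monomial_basis : exists u : 'I_n -> R -> R,
  [/\ forall j, real_laplace_L1 Sigma (u j),
      forall j s, Sigma s -> real_laplace (u j) s = phi s * s ^+ j & same_span v u].
Proof.
have [P sP PE] : exists2 P : I -> {poly R}, forall i, (size (P i) <= n)%N &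
    forall i s, Sigma s -> real_laplace (g i) s = phi s * (P i).[s].
  have /choice[P PP] : forall i, exists P : {poly R}, (size P <= n)%N /\
      forall s, Sigma s -> real_laplace (g i) s = phi s * P.[s].
    by move=> i; have [P ? ?] := g_laplace i; exists P.
  by exists P => i; case: (PP i).
have /choice[C vC] := v_span.
pose M : 'M[R]_n := \matrix_(i, k) \sum_p C i p * (P p)`_k.
pose t i x := \sum_p C i p * g p x.
have tL1 i : real_laplace_L1 Sigma (t i) by apply: real_laplace_L1_sum.
have tlap i s : Sigma s -> real_laplace (t i) s = phi s * \sum_k M i k * s ^+ k.
  move=> Ss; rewrite (real_laplace_sum _ _ g_L1 Ss).
  under eq_bigr do rewrite PE// (horner_coef_wide _ (sP _)) mulrCA big_distrr/=.
  rewrite -big_distrr/= exchange_big/=; congr (_ * _); apply: eq_bigr => k _.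
  by rewrite mxE big_distrl/=; apply: eq_bigr => p _; rewrite mulrA.
have tlapM (y : 'I_n -> R) s : Sigma s ->
    real_laplace (fun x => \sum_i y i * t i x) s = phi s * \sum_k (\sum_i y i * M i k) * s ^+ k.
  move=> Ss; rewrite (real_laplace_sum _ _ tL1 Ss).
  under eq_bigr do rewrite tlap// mulrCA big_distrr/=.
  rewrite -big_distrr/= exchange_big/=; congr (_ * _); apply: eq_bigr => k _.
  by rewrite big_distrl/=; apply: eq_bigr => p _; rewrite mulrA.
have Munit : M \in unitmx.
  rewrite unitmxE unitfE; apply/negP => /det0P[y y0 yM].
  case/negP: y0; apply/eqP/rowP => i; rewrite mxE.
  apply: (v_independent (y := fun i => y ord0 i)).
  have : {ae mu, forall x, \sum_i y ord0 i * t i x = 0}.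
    apply: (real_laplace_eq0_ae Sigma_open Sigma_nonempty).
      exact: real_laplace_L1_sum.
    move=> s Ss; rewrite tlapM// big1 ?mulr0// => k _.
    by have /rowP/(_ k) := yM; rewrite !mxE => ->; rewrite mul0r.
  move=> t0; apply: ae_impl (ae_and t0 (ae_finite vC)) => x [tx e].
  rewrite -[RHS]tx.
  by apply: eq_bigr => k _; rewrite e.
pose u j x := \sum_i invmx M j i * t i x.
exists u; split.
- by move=> j; apply: real_laplace_L1_sum.
- move=> j s Ss; rewrite tlapM//; congr (_ * _).
  have MV k : \sum_i invmx M j i * M i k = (1%:M : 'M[R]_n) j k.
    by rewrite -(mulVmx Munit) mxE.
  rewrite (bigD1 j)//= MV mxE eqxx mul1r big1 ?addr0// => k kj.
  by rewrite MV mxE eq_sym (negPf kj) mul0r.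
- move=> h; split.
    apply: (@in_span_mul _ _ _ _ _ M) => i; apply: ae_impl (vC i) => x ->.
    rewrite /u; under [RHS]eq_bigr do rewrite big_distrr/=.
    rewrite exchange_big/= -/(t i x).
    have MV k : \sum_j M i j * invmx M j k = (1%:M : 'M[R]_n) i k.
      by rewrite -(mulmxV Munit) mxE.
    under [RHS]eq_bigr => k _.
      rewrite (eq_bigr (fun j => M i j * invmx M j k * t k x)); last by move=> j _; rewrite mulrA.
      rewrite -big_distrl/= MV mxE.
      over.
    by rewrite (bigD1 i)//= eqxx mul1r big1 ?addr0// => k; rewrite eq_sym => /negPf ->; rewrite mul0r.
  apply: (@in_span_mul _ _ _ _ _ (invmx M)) => j.
  apply: ae_impl (ae_finite vC) => x e; rewrite /u.
  by apply: eq_bigr => i _; rewrite e.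
Qed.
End polynomial_basis.

(** * Iterated primitives *)
Section iterated_primitive.
Context {R : realType}.
Local Notation mu := (@lebesgue_measure R).
Variables (Sigma : set R) (f : R -> R).
Hypotheses (Sigma_nonempty : Sigma !=set0) (Sigma_pos : forall s, Sigma s -> 0 < s).
Hypothesis f_L1 : real_laplace_L1 Sigma f.

Local Notation U k := (iter k primitive f).

Lemma real_laplace_L1_iter_primitive k : real_laplace_L1 Sigma (U k).
Proof.
elim: k => [|k IH] //= s Ss.
exact: real_laplace_L1_primitive Ss (Sigma_pos Ss) IH.
Qed.

Lemma real_laplace_iter_primitive k s : Sigma s ->
  real_laplace (U k) s = real_laplace f s / s ^+ k.
Proof.
move=> Ss; elim: k => [|k IH] /=; first by rewrite expr0 divr1.
rewrite (real_laplace_primitive Ss (Sigma_pos Ss) (real_laplace_L1_iter_primitive k)) IH.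
by rewrite exprSr invfM mulrA.
Qed.

Lemma left_integrable_iter k : left_integrable (U k).
Proof.
have [s Ss] := Sigma_nonempty.
exact: real_laplace_L1_left_integrable Ss (Sigma_pos Ss) (real_laplace_L1_iter_primitive k).
Qed.

Lemma continuous_iter_primitive k : continuous (U k.+1).
Proof. exact: primitive_continuous (left_integrable_iter k). Qed.

Lemma derivable_iter_primitive k x :
  derivable (U k.+2) x 1 /\ derive1 (U k.+2) x = U k.+1 x.
Proof.
exact: derivable_primitive (left_integrable_iter k.+1) (@continuous_iter_primitive k).
Qed.

(** Differentiating everywhere requires a continuous function, hence at least
    one primitive left after the i derivatives; [derive1n_iter_primitive_ae]
    covers the last derivative, which exists only a.e. *)
Lemma derive1n_iter_primitive i k : derive1n i (U (i + k.+1)) = U k.+1.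
Proof.
elim: i k => [|i IH] k; first by rewrite derive1n0.
rewrite derive1nS addSnnS IH; apply/funext => x.
by case: (derivable_iter_primitive k x).
Qed.

Lemma derive1n_iter_primitive_ae k i : (i <= k)%N ->
  {ae mu, forall x, derive1n i (U k) x = U (k - i) x}.
Proof.
rewrite leq_eqVlt => /predU1P[<-|ik]; last first.
  apply: aeW => x.
  have -> : k = (i + (k - i).-1.+1)%N by rewrite prednK ?subn_gt0// subnKC// ltnW.
  by rewrite derive1n_iter_primitive addKn.
rewrite subnn; case: i => [|i]; first exact: aeW.
rewrite derive1nS -[X in U X]addn1 derive1n_iter_primitive.
apply: derive_primitive_ae; last exact: (left_integrable_iter 0).
exact: real_laplace_L1_measurable f_L1.
Qed.
End iterated_primitive.

Local Open Scope complex_scope.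

Theorem proposition2p4 (R : realType)
  (Sigma : set R)
  (Sigma_open : open Sigma) (Sigma_interval : is_interval Sigma)
  (Sigma_nonempty : Sigma !=set0) (Sigma_pos : forall s, Sigma s -> 0 < s)
  (n r : nat) (n_ge1 : (1 <= n)%N) (r_ge1 : (1 <= r)%N)
  (nn : r.-tuple nat) (nn_step : step_line nn) (nn_sum : sumn nn = n)
  (a : 'I_r -> R[i]) (b : 'I_r -> R) (c s0 : R) (d1 d2 : 'I_r -> bool)
  (d12 : (forall i, d1 i) \/ (forall i, d2 i))
  (quotients_defined : forall s i, Sigma s -> d2 i -> s + b i != 0)
  (integrals_defined : forall s, Sigma s ->
     oriented_cintegrable s0 s (laplace_integrand a b d1 d2))
  (w : 'I_r -> R -> R)
  (w_L1 : forall j, laplace_L1 Sigma (fun x => (w j x)%:C))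
  (w_laplace : forall (j : 'I_r) s, Sigma s ->
     laplace (fun x => (w j x)%:C) s =
     laplace_factor a b d1 d2 c s0 s *
     (s%:C ^+ j / \prod_(i < r | (i <= j)%N) (s + b i)%:C ^+ d2 i))
  (omega : R -> R[i])
  (omega_L1 : laplace_L1 Sigma omega)
  (omega_laplace : forall s, Sigma s ->
     laplace omega s =
     laplace_factor a b d1 d2 c s0 s *
     (1 / \prod_(i < r) (s + b i)%:C ^+ (d2 i * tnth nn i)))
  (v : 'I_n -> R -> R) (v_MOPE : MOPE v w) :
  exists om : R -> R,
    {ae lebesgue_measure, forall x, omega x = (om x)%:C} /\ PE_ADT v om.
Proof.
have wL1 j : real_laplace_L1 Sigma (w j) := laplace_L1_Re (w_L1 j).
have DE m s : \prod_(i < r) (s + b i)%:C ^+ (d2 i * m i) =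
    ((weighted_denominator b d2 m).[s])%:C.
  rewrite /weighted_denominator horner_prod rmorph_prod; apply: eq_bigr => i _.
  by rewrite horner_exp !hornerE rmorphXn.
have D0 m s : Sigma s -> (weighted_denominator b d2 m).[s] != 0.
  by move=> Ss; apply: weighted_denominator_neq0 => i; exact: quotients_defined.
have wlapC (j : 'I_r) s : Sigma s ->
  (real_laplace (w j) s)%:C = laplace_factor a b d1 d2 c s0 s *
    (s ^+ j / (weighted_denominator b d2 (fun i => (i <= j)%N)).[s])%:C.
  move=> Ss; rewrite -laplace_real w_laplace//; congr (_ * _).
  rewrite rmorphM fmorphV rmorphXn; congr (_ / _).
  apply: etrans (DE _ s); rewrite [LHS]big_mkcond/=.
  by apply: eq_bigr => i _; case: (i <= j)%N; rewrite ?muln1 ?muln0.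
(* As r >= 1, the function w_0 is available, and its real transform forces Phi
   to be real. *)
have Phi_real s : Sigma s -> complex.Im (laplace_factor a b d1 d2 c s0 s) = 0.
  move=> Ss; have := wlapC (Ordinal r_ge1) s Ss; rewrite expr0 div1r.
  set D := (_ .[s])^-1; case: laplace_factor => x y; simpc => -[_ /eqP].
  by rewrite eq_sym mulf_eq0 invr_eq0 (negPf (D0 _ _ Ss)) orbF => /eqP.
pose phi s := complex.Re (laplace_factor a b d1 d2 c s0 s).
have PhiE s : Sigma s -> laplace_factor a b d1 d2 c s0 s = (phi s)%:C.
  by move=> /Phi_real; rewrite /phi; case: laplace_factor => x y /= ->.
have [p sp ODE] := laplace_factor_ODE Sigma_open quotients_defined
  integrals_defined Phi_real.
have wlap (j : 'I_r) s : Sigma s -> real_laplace (w j) s = phi s *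
    (s ^+ j / (weighted_denominator b d2 (fun i => (i <= j)%N)).[s]).
  by move=> Ss; apply: complexI; rewrite wlapC// PhiE// -rmorphM.
pose q := weighted_denominator b d2 (tnth nn).
have nnE : (\sum_i tnth nn i = n)%N by rewrite -nn_sum sumnE big_tuple.
have [v_PE [nn' [nn'_step nn'_sum v_span]]] := v_MOPE.
have {nn' nn'_step nn'_sum v_span} v_span : same_span v (@mope_functions R r w nn).
  have <- // : nn' = nn by apply: step_line_uniq; rewrite // nn'_sum nn_sum.
pose psi s := phi s / q.[s].
have [] := @exists_monomial_basis R Sigma psi n _ (@mope_functions R r w nn)
  Sigma_open Sigma_nonempty _ _ v _ _.
- by move=> [j k]; exact: (real_laplace_L1_mulXn k Sigma_open (wL1 j)).
- move=> [j k]; have kn (i : 'I_r) : (k + (i <= j)%N <= tnth nn i)%N.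
    have [ij|ji] := leqP i j; have := step_line_leq i j nn_step;
      have := step_line_leq j i nn_step; have := ltn_ord k; rewrite /=; move: ij || move: ji; lia.
  have [P sP PE] := real_laplace_monomial_weight_common Sigma_open quotients_defined sp ODE wL1
    (wlap j) kn.
  exists P; first by rewrite -nnE.
  by move=> s Ss; rewrite PE// mulrCA mulrC.
- by move=> i; apply/v_span; exact: in_span_mem.
- by move=> y; exact: polynomial_ensemble_independent v_PE.
move=> u [uL1 ulap vu].
have n1n : (n.-1 < n)%N by rewrite prednK.
(* All primitives start from the basis function whose transform is Phi s^(n-1) / Q. *)
pose top : 'I_n := Ordinal n1n.
pose U k := iter k primitive (u top).
have UL1 k : real_laplace_L1 Sigma (U k) := real_laplace_L1_iter_primitive Sigma_pos (uL1 top) k.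
have Ulap k s : (k <= n.-1)%N -> Sigma s -> real_laplace (U k) s = psi s * s ^+ (n.-1 - k).
  move=> kn Ss; rewrite (real_laplace_iter_primitive Sigma_pos (uL1 top))// ulap//.
  by rewrite -mulrA -expfB_cond// gt_eqF// Sigma_pos.
have Uu (j : 'I_n) : {ae lebesgue_measure, forall x, u j x = U (n.-1 - j)%N x}.
  have jn : (j <= n.-1)%N by rewrite -ltnS prednK.
  apply: (real_laplace_inj_ae Sigma_open Sigma_nonempty) => // s Ss.
  by rewrite ulap// Ulap ?leq_subr// subKn.
have omegaE s : Sigma s -> laplace omega s = (psi s)%:C.
  by move=> Ss; rewrite omega_laplace// DE PhiE// div1r -fmorphV -rmorphM.
exists (U n.-1); split.
  have Re_om : {ae lebesgue_measure, forall x, complex.Re (omega x) = U n.-1 x}.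
    apply: (real_laplace_inj_ae Sigma_open Sigma_nonempty) => //; first exact: laplace_L1_Re.
    move=> s Ss; rewrite Ulap// subnn expr0 mulr1.
    by have := omegaE s Ss; rewrite laplaceE => -[].
  have Im_om : {ae lebesgue_measure, forall x, complex.Im (omega x) = 0}.
    apply: (real_laplace_eq0_ae Sigma_open Sigma_nonempty); first exact: laplace_L1_Im.
    by move=> s Ss; have := omegaE s Ss; rewrite laplaceE => -[].
  by apply: ae_impl (ae_and Re_om Im_om) => x; case: (omega x) => y z /= [-> ->].
split=> //; split.
  move=> n2.
  have dU i : (i <= n - 2)%N -> derive1n i (U n.-1) = U (n - 2 - i).+1.
    move=> i_n; have -> : n.-1 = (i + (n - 2 - i).+1)%N by lia.
    exact: derive1n_iter_primitive Sigma_nonempty Sigma_pos (uL1 top) _ _.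
  rewrite /continuously_differentiable dU// subnn; split; first split.
  - move=> i i_n x; rewrite dU; last exact: ltnW.
    rewrite -(prednK (n := n - 2 - i)) ?subn_gt0//.
    by have [] := derivable_iter_primitive Sigma_nonempty Sigma_pos (uL1 top) (n - 2 - i).-1 x.
  - exact: (continuous_iter_primitive Sigma_nonempty Sigma_pos (uL1 top)).
  - exact: primitive_AC (left_integrable_iter Sigma_nonempty Sigma_pos (uL1 top) 0%N).
apply: same_span_ae vu => j.
have jn : (j <= n.-1)%N by rewrite -ltnS prednK.
have dj := derive1n_iter_primitive_ae Sigma_nonempty Sigma_pos (uL1 top) jn.
by apply: ae_impl (ae_and (Uu j) dj) => x [-> ->].
Qed.
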